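(* Let $a<b$ be real numbers and let $m,l,n\in\mathbb{N}$ (positive integers). Let $A\in(C^{(n-1)})^{m\times m}$ and $A_k\in(C^{(n-1)})^{m\times m}$ for $k\in\mathbb{N}$, and let $B\colon(C^{(n)})^{m}\to\mathbb{C}^{l}$ and $B_k\colon(C^{(n)})^{m}\to\mathbb{C}^{l}$, $k\in\mathbb{N}$, be continuous linear operators. Put $Ly:=y'+Ay$ and $L_ky:=y'+A_ky$ for $y\in(C^{(n)})^m$, and consider the continuous linear operators $$(L,B),\ (L_k,B_k)\colon (C^{(n)})^m\to (C^{(n-1)})^m\times\mathbb{C}^{l},\qquad (L,B)y=(Ly,By),\quad (L_k,B_k)y=(L_ky,B_ky).$$ If $(L_k,B_k)$ converges to $(L,B)$ in the strong operator topology as $k\to\infty$, then the characteristic matrices satisfy $M(L_k,B_k)\to M(L,B)$ in $\mathbb{C}^{l\times m}$ as $k\to\infty$.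
   Context: For an integer $n\ge 0$, $C^{(n)}$ denotes the complex Banach space of all $n$ times continuously differentiable functions $x\colon[a,b]\to\mathbb{C}$ with norm $\|x\|_{(n)}=\sum_{j=0}^{n}\max_{a\le t\le b}|x^{(j)}(t)|$; $C^{(0)}=C$ is the space of continuous functions. $(C^{(n)})^m$ and $(C^{(n)})^{m\times m}$ are the complex Banach spaces of $m$-dimensional (column) vector functions and of $m\times m$ matrix functions, respectively, with all components in $C^{(n)}$; the norm of a vector function is the sum of the norms of its components, and the norm of a matrix function is the maximum of the norms of its columns. Characteristic matrix: let $Y\in(C^{(n)})^{m\times m}$ be the unique solution of the matrix Cauchy problem $Y'(t)+A(t)Y(t)=O_m$ for $t\in(a,b)$, $Y(a)=I_m$, where $O_m$ and $I_m$ are the zero and identity $m\times m$ matrices. The characteristic matrix $M(L,B)$ is the $l\times m$ complex matrix whose $j$-th column is the result of applying $B$ to the $j$-th column of $Y$, for $j=1,\dots,m$. The matrix $M(L_k,B_k)$ is defined in the same way with $A_k$, $B_k$ in place of $A$, $B$. *)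

(* Defs.v *)
From HB Require Import structures.
From mathcomp Require Import all_boot all_order all_algebra.
From mathcomp Require Import complex.
From mathcomp Require Import all_classical all_reals all_analysis.

Set Implicit Arguments.
Unset Strict Implicit.
Unset Printing Implicit Defensive.

Import Order.TTheory GRing.Theory Num.Theory.
Import numFieldNormedType.Exports.

Local Open Scope classical_set_scope.
Local Open Scope complex_scope.
Local Open Scope ring_scope.

HB.instance Definition _ (R : rcfType) := NormedModule.copy R[i] R[i]^o.

(* Type class resolution misses [nbhs_pfilter] on R[i] and on [a, b]. *)
#[global] Instance complex_nbhs_filter (R : rcfType) (z : R[i]) :
  ProperFilter (nbhs z) := nbhs_pfilter z.

#[global] Instance seg_nbhs_filter (R : realType) (a b : R)
  (t : set_type `[a, b]%classic) : ProperFilter (nbhs t) := nbhs_pfilter t.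

Notation seg a b := (set_type `[a, b]%classic).

Section derivative.
Context {R : realType} {a b : R}.
Implicit Types x y : seg a b -> R[i].

Definition quot x (t s : seg a b) : R[i] :=
  (x s - x t) / (\val s - \val t)%:C.

(* [t^'] is the punctured neighbourhood filter in the space [a, b], so that *)
(* the derivative is one-sided at the end points.                           *)
Definition derivable_at x (t : seg a b) : Prop := cvg (quot x t @ t^').

Definition cderive x : seg a b -> R[i] := fun t => lim (quot x t @ t^').

Fixpoint Cdiff (n : nat) x : Prop :=
  if n is n'.+1 then (forall t, derivable_at x t) /\ Cdiff n' (cderive x)
  else continuous x.

(* A maximum for continuous x, since [a, b] is compact. *)
Definition supnorm x : R := sup (range (fun t => complex.Re `|x t|)).

Definition Cnorm (n : nat) x : R := \sum_(j < n.+1) supnorm (iter j cderive x).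

End derivative.


Section derivative_theory.
Context {R : realType}.

Lemma normC_real (r : R) : `|r%:C : R[i]| = (`|r|)%:C.
Proof. by rewrite normc_def /= expr0n addr0 sqrtr_sqr. Qed.

Lemma normC_Re (z : R[i]) : `|z| = (complex.Re `|z|)%:C.
Proof. by case: z. Qed.

Lemma Re_norm_ge0 (z : R[i]) : 0 <= complex.Re `|z|.
Proof. by rewrite -lecR -normC_Re; exact: normr_ge0. Qed.

Lemma Re_normD (z w : R[i]) :
  complex.Re `|z + w| <= complex.Re `|z| + complex.Re `|w|.
Proof. by rewrite -lecR rmorphD /= -!normC_Re ler_normD. Qed.

Lemma Re_normM (z w : R[i]) :
  complex.Re `|z * w| = complex.Re `|z| * complex.Re `|w|.
Proof. by apply: complexI; rewrite rmorphM /= -!normC_Re normrM. Qed.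

Lemma Re_norm_dist (z w : R[i]) :
  `|complex.Re `|z| - complex.Re `|w| | <= complex.Re `|z - w|.
Proof.
rewrite -lecR -normC_Re -normC_real rmorphB /= -!normC_Re.
exact: ler_dist_dist.
Qed.

Lemma Re_norm_continuous : continuous (fun z : R[i] => complex.Re `|z|).
Proof.
move=> z; apply/cvgrPdist_lt => e e0.
have e0' : 0 < e%:C :> R[i] by rewrite ltcR.
apply: filterS (nbhsx_ballx z _ e0') => w /=; rewrite -ball_normE /= => zw.
by apply: le_lt_trans (Re_norm_dist _ _) _; rewrite -ltcR -normC_Re.
Qed.

Lemma real_complex_continuous : continuous (fun r : R => r%:C : R[i]).
Proof.
move=> z; apply/cvgrPdist_lt => e e0.
have eE : e = (complex.Re e)%:C.
  by move: e0; case: e => u v; rewrite ltcE /= => /andP[/eqP->].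
have e0' : 0 < complex.Re e by rewrite -ltcR -eE.
apply: filterS (nbhsx_ballx z _ e0') => w /=; rewrite -ball_normE /= => zw.
by rewrite -rmorphB /= normC_real eE ltcR.
Qed.

Context {a b : R} (hab : a < b).
Implicit Types x y : seg a b -> R[i].

Lemma seg_val_continuous : continuous (\val : seg a b -> R).
Proof. exact: initial_continuous. Qed.

Lemma seg_proper (t : seg a b) : ProperFilter t^'.
Proof.
split; last exact: dnbhs_filter.
move=> [_ [[U oU <-] /= Ut] sub].
move: oU; rewrite openE => /(_ _ Ut) /nbhs_ballP[e /= e0 eU].
have /set_mem /= := valP t; rewrite in_itv /= => /andP[at_ tb].
suff [s [st abs ste]] : exists s : R, [/\ s != \val t, s \in `[a, b] & `|\val t - s| < e].
  have sP : s \in `[a, b]%classic by rewrite inE.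
  apply: (sub (exist _ s sP)); first exact: eU.
  by apply: contra st => /eqP <-.
have [tlt|tge] := ltP (\val t) b.
  exists (\val t + Num.min (e / 2) (b - \val t)).
  have m0 : 0 < Num.min (e / 2) (b - \val t) by rewrite lt_min divr_gt0 //= subr_gt0.
  have mb : Num.min (e / 2) (b - \val t) <= b - \val t by rewrite ge_min lexx orbT.
  have me : Num.min (e / 2) (b - \val t) <= e / 2 by rewrite ge_min lexx.
  split.
  - by rewrite gt_eqF // ltrDl.
  - by rewrite in_itv /= -lerBrDl mb andbT ler_wpDr // ltW.
  - by rewrite opprD addNKr normrN gtr0_norm // (le_lt_trans me) // gtr_pMr // invf_lt1 // ltr1n.
have tE : \val t = b by apply/eqP; rewrite eq_le tb.
exists (b - Num.min (e / 2) (b - a)); rewrite tE.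
have m0 : 0 < Num.min (e / 2) (b - a) by rewrite lt_min divr_gt0 //= subr_gt0.
have mb : Num.min (e / 2) (b - a) <= b - a by rewrite ge_min lexx orbT.
have me : Num.min (e / 2) (b - a) <= e / 2 by rewrite ge_min lexx.
split.
- by rewrite lt_eqF // gtrBl.
- by rewrite in_itv /= lerBrDr -lerBrDl mb /= gerBl ltW.
- by rewrite opprB addrC subrK gtr0_norm // (le_lt_trans me) // gtr_pMr // invf_lt1 // ltr1n.
Qed.

Lemma seg_dnbhs_cvg (T : topologicalType) (f : seg a b -> T) (t : seg a b) :
  {for t, continuous f} -> f @ t^' --> f t.
Proof. by move=> cf; apply: cvg_trans cf; apply: cvg_app; exact: nbhs_dnbhs. Qed.

Lemma derivable_cvg x t : derivable_at x t -> quot x t @ t^' --> cderive x t.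
Proof. by []. Qed.

Lemma derivable_eq x t d : quot x t @ t^' --> d ->
  derivable_at x t /\ cderive x t = d.
Proof.
move=> xd; split; first by apply/cvg_ex; exists d.
by have := seg_proper t => P; apply: (@cvg_lim _ (@norm_hausdorff _ _)).
Qed.

Lemma derivableD x y t : derivable_at x t -> derivable_at y t ->
  derivable_at (x + y) t /\ cderive (x + y) t = cderive x t + cderive y t.
Proof.
move=> dx dy; apply: derivable_eq; have P := seg_proper t.
have -> : quot (x + y) t = quot x t + quot y t.
  by apply/funext => s; rewrite /quot !fctE -mulrDl opprD addrACA.
exact: (cvgD (derivable_cvg dx) (derivable_cvg dy)).
Qed.

Lemma derivableZ c x t : derivable_at x t ->
  derivable_at (c *: x) t /\ cderive (c *: x) t = c * cderive x t.
Proof.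
move=> dx; apply: derivable_eq; have P := seg_proper t.
have -> : quot (c *: x) t = (fun s => c * quot x t s).
  by apply/funext => s; rewrite /quot mulrA mulrBr.
exact: (cvgM (cvg_cst c) (derivable_cvg dx)).
Qed.

Lemma quotK x t s : s != t -> x s = x t + quot x t s * (\val s - \val t)%:C.
Proof.
move=> st; rewrite /quot divfK; first by rewrite addrC subrK.
by rewrite (inj_eq (@complexI _)) subr_eq0 (inj_eq val_inj).
Qed.

Lemma derivable_dnbhs x t : derivable_at x t -> x @ t^' --> x t.
Proof.
move=> dx; have P := seg_proper t.
have : (fun s => x t + quot x t s * (\val s - \val t)%:C) @ t^' --> x t.
  rewrite -[X in _ --> X]addr0; apply: cvgD; first exact: cvg_cst.
  rewrite -[X in _ --> X](mulr0 (cderive x t)).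
  apply: (cvgM (derivable_cvg dx)).
  rewrite -[X in _ --> X]/((0 : R)%:C) -(subrr (\val t)).
  apply: (@seg_dnbhs_cvg _ (fun s => (\val s - \val t)%:C : R[i]) t).
  apply: (@continuous_comp _ _ _ (fun s : seg a b => \val s - \val t)
    (fun r : R => r%:C)); last exact: real_complex_continuous.
  exact: (cvgB (@seg_val_continuous t) (cvg_cst (\val t))).
apply: cvg_trans; apply: near_eq_cvg.
by near=> s; rewrite -quotK //; near: s; exact: nbhs_dnbhs_neq.
Unshelve. all: by end_near. Qed.

Lemma derivable_continuous x t : derivable_at x t -> {for t, continuous x}.
Proof.
move=> /derivable_dnbhs xt.
apply/cvgrPdist_lt => e e0.
move/cvgrPdist_lt : xt => /(_ _ e0); rewrite /dnbhs near_withinE.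
apply: filterS => s xts; have [->|/eqP/xts//] := pselect (s = t).
by rewrite subrr normr0.
Qed.

Lemma derivableM x y t : derivable_at x t -> derivable_at y t ->
  derivable_at (x * y) t /\
  cderive (x * y) t = cderive x t * y t + x t * cderive y t.
Proof.
move=> dx dy; apply: derivable_eq; have P := seg_proper t.
have -> : quot (x * y) t = (fun s => quot x t s * y s + x t * quot y t s).
  apply/funext => s; rewrite /quot !fctE; set d := _^-1.
  rewrite (mulrAC (x s - x t)) (mulrA (x t)) -mulrDl; congr (_ * d).
  by rewrite mulrBl mulrBr addrA subrK.
apply: cvgD; first exact: (cvgM (derivable_cvg dx) (derivable_dnbhs dy)).
exact: (cvgM (cvg_cst (x t)) (derivable_cvg dy)).
Qed.

Lemma Cdiff_continuous n x : Cdiff n x -> continuous x.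
Proof. by case: n => [//|n] [dx _] t; exact: derivable_continuous. Qed.

Lemma CdiffS n x : Cdiff n.+1 x -> Cdiff n x.
Proof.
elim: n x => [|n IH] x; first by move=> [dx _] t; exact: derivable_continuous.
by move=> [dx /IH].
Qed.

Lemma cderiveD n x y : Cdiff n.+1 x -> Cdiff n.+1 y ->
  cderive (x + y) = cderive x + cderive y.
Proof.
by move=> [dx _] [dy _]; apply/funext => t; have [] := derivableD (dx t) (dy t).
Qed.

Lemma cderiveZ n c x : Cdiff n.+1 x -> cderive (c *: x) = c *: cderive x.
Proof. by move=> [dx _]; apply/funext => t; have [] := derivableZ c (dx t). Qed.

Lemma CdiffD n x y : Cdiff n x -> Cdiff n y -> Cdiff n (x + y).
Proof.
elim: n x y => [x y cx cy t|n IH x y Cx Cy].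
  exact: (cvgD (cx t) (cy t)).
split; last by rewrite (cderiveD Cx Cy); apply: IH; [case: Cx|case: Cy].
by move: Cx Cy => [dx _] [dy _] t; have [] := derivableD (dx t) (dy t).
Qed.

Lemma CdiffZ n c x : Cdiff n x -> Cdiff n (c *: x).
Proof.
elim: n x => [x cx t|n IH x Cx].
  exact: (cvgM (cvg_cst c) (cx t)).
split; last by rewrite (cderiveZ _ Cx); apply: IH; case: Cx.
by move: Cx => [dx _] t; have [] := derivableZ c (dx t).
Qed.

Lemma CdiffM n x y : Cdiff n x -> Cdiff n y -> Cdiff n (x * y).
Proof.
elim: n x y => [x y cx cy t|n IH x y Cx Cy].
  exact: (cvgM (cx t) (cy t)).
have E : cderive (x * y) = cderive x * y + x * cderive y.
  by apply/funext => t; case: Cx Cy => [dx _] [dy _]; have [] := derivableM (dx t) (dy t).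
split.
  by move: Cx Cy => [dx _] [dy _] t; have [] := derivableM (dx t) (dy t).
rewrite E; apply: CdiffD; apply: IH => //; try exact: CdiffS.
  by case: Cx.
by case: Cy.
Qed.

Lemma Cdiff0 n : Cdiff n (0 : seg a b -> R[i]).
Proof.
elim: n => [t|n IH]; first exact: cvg_cst.
have H (t : seg a b) : quot 0 t @ t^' --> (0 : R[i]).
  have -> : quot 0 t = cst 0.
    by apply/funext => s; rewrite /quot subrr mul0r.
  exact: cvg_cst.
split=> [t|]; first by have [] := derivable_eq (H t).
suff -> : cderive (0 : seg a b -> R[i]) = 0 by [].
by apply/funext => t; have [] := derivable_eq (H t).
Qed.

Lemma cderive_iterC n j x : (j <= n)%N -> Cdiff n x ->
  Cdiff (n - j) (iter j cderive x).
Proof.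
elim: j => [|j IH] jn Cx; first by rewrite subn0.
by move: (IH (ltnW jn) Cx); rewrite -(subnSK jn) => -[].
Qed.

Lemma cderive_iterD n j x y : (j <= n)%N -> Cdiff n x -> Cdiff n y ->
  iter j cderive (x + y) = iter j cderive x + iter j cderive y.
Proof.
move=> + Cx Cy; elim: j => [//|j IH] jn; rewrite 3!iterS IH 1?ltnW //.
apply: (@cderiveD (n - j.+1)); rewrite subnSK //.
  by apply: cderive_iterC Cx; exact: ltnW.
by apply: cderive_iterC Cy; exact: ltnW.
Qed.

Lemma cderive_iterZ n j c x : (j <= n)%N -> Cdiff n x ->
  iter j cderive (c *: x) = c *: iter j cderive x.
Proof.
move=> + Cx; elim: j => [//|j IH] jn; rewrite 2!iterS IH 1?ltnW //.
apply: (@cderiveZ (n - j.+1)); rewrite subnSK //.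
by apply: cderive_iterC Cx; exact: ltnW.
Qed.

Lemma seg_ltW : a \in `[a, b]%classic.
Proof. by rewrite inE /= in_itv /= lexx ltW. Qed.

Lemma supnorm_has_sup x : continuous x ->
  has_sup (range (fun t => complex.Re `|x t|)).
Proof.
move=> cx; split; first by exists (complex.Re `|x (exist _ a seg_ltW)|), (exist _ a seg_ltW).
pose f (t : seg a b) := complex.Re `|x t|.
have cf : continuous f.
  by move=> t; apply: continuous_comp; [exact: cx|exact: Re_norm_continuous].
have /(EVT_max (ltW hab))[c cab cmax] :
  {within `[a, b], continuous (valL_ 0 f)}.
  exact/subspace_valL_continuousP'.
exists (valL_ 0 f c) => _ [t _ <-].
have /cmax : \val t \in `[a, b] by have /set_mem := valP t.
by rewrite -[leLHS]/(sigL _ (valL_ 0 f) t) valLK.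
Qed.

Lemma supnorm_ub x t : continuous x -> complex.Re `|x t| <= supnorm x.
Proof.
by move=> /supnorm_has_sup[_ ub]; apply: ub_le_sup => //; exists t.
Qed.

Lemma supnorm_le x M : (forall t, complex.Re `|x t| <= M) -> supnorm x <= M.
Proof.
move=> xM; apply: ge_sup; last by move=> _ [t _ <-].
by exists (complex.Re `|x (exist _ a seg_ltW)|), (exist _ a seg_ltW).
Qed.

Lemma supnormD x y : continuous x -> continuous y ->
  supnorm (x + y) <= supnorm x + supnorm y.
Proof.
move=> cx cy; apply: supnorm_le => t; apply: le_trans (Re_normD _ _) _.
by rewrite lerD // supnorm_ub.
Qed.

Lemma supnorm_ge0 x : continuous x -> 0 <= supnorm x.
Proof.
by move=> cx; apply: le_trans (supnorm_ub (exist _ a seg_ltW) cx); exact: Re_norm_ge0.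
Qed.

Lemma supnormZ_le c x : continuous x ->
  supnorm (c *: x) <= complex.Re `|c| * supnorm x.
Proof.
move=> cx; apply: supnorm_le => t; rewrite Re_normM.
by rewrite ler_wpM2l ?Re_norm_ge0 ?supnorm_ub.
Qed.

Lemma supnormZ c x : continuous x ->
  supnorm (c *: x) = complex.Re `|c| * supnorm x.
Proof.
move=> cx; apply/eqP; rewrite eq_le supnormZ_le // andTb.
have [->|c0] := eqVneq c 0.
  rewrite normr0 mul0r scale0r.
  exact/supnorm_ge0/(@Cdiff0 0).
have cx' : continuous (c *: x) by exact: (@CdiffZ 0).
have c1 : complex.Re `|c^-1| * complex.Re `|c| = 1.
  by rewrite -Re_normM mulVf // normr1.
have cp : 0 < complex.Re `|c| by rewrite -ltcR -normC_Re normr_gt0.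
rewrite -ler_pdivlMl //; have := supnormZ_le c^-1 cx'.
rewrite scalerA mulVf // scale1r.
suff -> : complex.Re `|c^-1| = (complex.Re `|c|)^-1 by [].
by apply: (mulIf (lt0r_neq0 cp)); rewrite c1 mulVf // lt0r_neq0.
Qed.

Lemma Cdiff_iter n j x : (j <= n)%N -> Cdiff n x ->
  continuous (iter j cderive x).
Proof. by move=> jn /(cderive_iterC jn)/Cdiff_continuous. Qed.

Lemma CnormD n x y : Cdiff n x -> Cdiff n y ->
  Cnorm n (x + y) <= Cnorm n x + Cnorm n y.
Proof.
move=> Cx Cy; rewrite /Cnorm -big_split /=; apply: ler_sum => -[j /= jn] _.
rewrite (cderive_iterD _ Cx Cy) //.
by apply: supnormD; apply: (@Cdiff_iter n).
Qed.

Lemma CnormZ n c x : Cdiff n x -> Cnorm n (c *: x) = complex.Re `|c| * Cnorm n x.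
Proof.
move=> Cx; rewrite /Cnorm mulr_sumr; apply: eq_bigr => -[j /= jn] _.
by rewrite (cderive_iterZ _ _ Cx) // supnormZ //; apply: (@Cdiff_iter n).
Qed.

Lemma Cnorm_ge0 n x : Cdiff n x -> 0 <= Cnorm n x.
Proof.
move=> Cx; apply: sumr_ge0 => -[j /= jn] _; apply: supnorm_ge0.
exact: (@Cdiff_iter n).
Qed.

Lemma Cnorm_eq0 n x : Cdiff n x -> Cnorm n x = 0 -> x = 0.
Proof.
move=> Cx x0; apply/funext => t; apply/eqP; rewrite -normr_eq0 normC_Re.
rewrite (inj_eq (@complexI _)) eq_le Re_norm_ge0 andbT -x0.
apply: le_trans (supnorm_ub t (Cdiff_continuous Cx)) _.
rewrite /Cnorm big_ord_recl /= lerDl; apply: sumr_ge0 => -[j /= jn] _.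
by apply: supnorm_ge0; apply: (@Cdiff_iter n j.+1).
Qed.

End derivative_theory.

Section Cspace.
Context {R : realType} {a b : R}.

(* The argument of type [a < b] is not used by the predicate, but the vector *)
(* space structure below depends on it (derivatives are unique if a < b).    *)
Definition Cpred (hab : a < b) (n : nat) : {pred seg a b -> R[i]} :=
  fun x => `[< Cdiff n x >].

Context (hab : a < b) (n : nat).

Record Cspace := MkCspace {
  Cfun :> seg a b -> R[i];
  _ : Cfun \in Cpred hab n }.

Implicit Types x y : Cspace.

HB.instance Definition _ := [isSub for Cfun].
HB.instance Definition _ := [Choice of Cspace by <:].

Lemma Cpred_submod : submod_closed (Cpred hab n).
Proof.
split=> [|c x y /asboolP Cx /asboolP Cy]; apply/asboolP; first exact: Cdiff0.
by apply: CdiffD => //; exact: CdiffZ.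
Qed.

HB.instance Definition _ :=
  GRing.isSubmodClosed.Build R[i] (seg a b -> R[i]) (Cpred hab n) Cpred_submod.
HB.instance Definition _ := [SubChoice_isSubLmodule of Cspace by <:].

Lemma CspaceP x : Cdiff n x.
Proof. by case: x => x /= /asboolP. Qed.

Lemma Cspace_normD x y :
  (Cnorm n (x + y : Cspace))%:C <= (Cnorm n x)%:C + (Cnorm n y)%:C :> R[i].
Proof. by rewrite -rmorphD /= lecR; apply: CnormD => //; exact: CspaceP. Qed.

Lemma Cspace_normZ (c : R[i]) x :
  (Cnorm n (c *: x : Cspace))%:C = `|c| * (Cnorm n x)%:C :> R[i].
Proof.
rewrite [`|c|]normC_Re -rmorphM; congr (_%:C).
by rewrite -CnormZ //; exact: CspaceP.
Qed.

Lemma Cspace_norm_eq0 x : (Cnorm n x)%:C = 0 :> R[i] -> x = 0.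
Proof.
by move=> /complexI x0; apply: val_inj; apply: (Cnorm_eq0 hab (CspaceP x) x0).
Qed.

HB.instance Definition _ := Lmodule_isNormed.Build R[i] Cspace
  Cspace_normD Cspace_normZ Cspace_norm_eq0.

Lemma Cspace_normE x : `|x| = (Cnorm n x)%:C.
Proof. by []. Qed.

End Cspace.

Section Coperations.
Context {R : realType} {a b : R} {hab : a < b} {n : nat}.

Fact Cderive_subproof (x : Cspace hab n.+1) : cderive x \in Cpred hab n.
Proof. by apply/asboolP; case: (CspaceP x). Qed.

Definition Cderive (x : Cspace hab n.+1) : Cspace hab n :=
  MkCspace (Cderive_subproof x).

Fact Cmul_subproof (c : Cspace hab n) (x : Cspace hab n.+1) :
  ((c : seg a b -> R[i]) * (x : seg a b -> R[i])) \in Cpred hab n.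
Proof.
apply/asboolP; apply: (CdiffM hab (CspaceP c)).
exact: (CdiffS hab (CspaceP x)).
Qed.

Definition Cmul (c : Cspace hab n) (x : Cspace hab n.+1) : Cspace hab n :=
  MkCspace (Cmul_subproof c x).

End Coperations.

Section Cvector.
Context {R : realType} {a b : R}.

Definition Cvec (hab : a < b) (n m : nat) := {ffun 'I_m -> Cspace hab n}.

Context (hab : a < b) (n m : nat).

HB.instance Definition _ := GRing.Lmodule.on (Cvec hab n m).

Definition Cvec_norm (y : Cvec hab n m) : R[i] := \sum_i `|y i|.

Lemma Cvec_normD (x y : Cvec hab n m) :
  Cvec_norm (x + y) <= Cvec_norm x + Cvec_norm y.
Proof.
rewrite /Cvec_norm -big_split /=; apply: ler_sum => i _.
by rewrite ffunE; exact: ler_normD.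
Qed.

Lemma Cvec_normZ (c : R[i]) (x : Cvec hab n m) :
  Cvec_norm (c *: x) = `|c| * Cvec_norm x.
Proof.
rewrite /Cvec_norm mulr_sumr; apply: eq_bigr => i _.
by rewrite ffunE; exact: normrZ.
Qed.

Lemma Cvec_norm_eq0 (x : Cvec hab n m) : Cvec_norm x = 0 -> x = 0.
Proof.
move=> /eqP; rewrite psumr_eq0 // => /allP x0; apply/ffunP => i.
by rewrite ffunE; apply/normr0_eq0/eqP/x0; rewrite mem_index_enum.
Qed.

HB.instance Definition _ := Lmodule_isNormed.Build R[i] (Cvec hab n m)
  Cvec_normD Cvec_normZ Cvec_norm_eq0.

End Cvector.

Section boundary_value_problem.
Context {R : realType} {a b : R} {hab : a < b} {n m l : nat}.

Definition seg_left : seg a b := exist _ a (seg_ltW hab).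

Definition diffop (A : 'M[Cspace hab n]_m) (y : Cvec hab n.+1 m) :
    Cvec hab n m :=
  [ffun i => Cderive (y i) + \sum_j Cmul (A i j) (y j)].

Definition bvp_op (A : 'M[Cspace hab n]_m) (B : Cvec hab n.+1 m -> 'cV[R[i]]_l)
    (y : Cvec hab n.+1 m) : Cvec hab n m * 'cV[R[i]]_l :=
  (diffop A y, B y).

Definition matrix_cauchy (A : 'M[Cspace hab n]_m)
    (Y : 'M[Cspace hab n.+1]_m) : Prop :=
  (forall t : seg a b, a < \val t < b ->
     (\matrix_(i, j) cderive (Y i j) t)
       + (\matrix_(i, j) A i j t) *m (\matrix_(i, j) Y i j t) = 0)
  /\ (\matrix_(i, j) Y i j seg_left) = 1%:M.

Definition Ccol (Y : 'M[Cspace hab n.+1]_m) (j : 'I_m) : Cvec hab n.+1 m :=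
  [ffun i => Y i j].

(* This is M(L, B) when [Y] solves [matrix_cauchy A Y]; such a [Y] is unique. *)
Definition charmx (B : Cvec hab n.+1 m -> 'cV[R[i]]_l)
    (Y : 'M[Cspace hab n.+1]_m) : 'M[R[i]]_(l, m) :=
  \matrix_(i, j) B (Ccol Y j) i 0.

End boundary_value_problem.

Definition sot_cvg (U : Type) (V : topologicalType)
    (T : nat -> U -> V) (T0 : U -> V) : Prop :=
  forall u, (fun k => T k u) @ \oo --> T0 u.

(* Main.v *)
Require Import Defs.
From HB Require Import structures.
From mathcomp Require Import all_boot all_order all_algebra.
From mathcomp Require Import complex ring lra.
From mathcomp Require Import all_classical all_reals all_analysis.

Set Implicit Arguments.
Unset Strict Implicit.
Unset Printing Implicit Defensive.

Import Order.TTheory GRing.Theory Num.Theory.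
Import numFieldNormedType.Exports.

Local Open Scope classical_set_scope.
Local Open Scope complex_scope.
Local Open Scope ring_scope.

(** Write [y] for the [j]-th column of [Y] and [y_k] for that of [Y_k].  The
strong convergence of [L_k], applied to constant vectors, bounds [A_k] in
[C^n].  The difference [z_k = y_k - y] vanishes at [a] and satisfies
[L_k z_k = L y - L_k y], which tends to 0, so Gronwall's inequality and a
bootstrap through [z' = L_k z - A_k z] give [z_k -> 0] in [C^(n+1)].  By the
uniform boundedness principle (for complex scalars, by
Sokal's argument from the completeness of [C^(n+1)]) the [B_k] are
equicontinuous, and [B_k y_k - B y = B_k z_k + (B_k y - B y)] tends to 0. *)

(** * Calculus on [a, b] *)

(** Strong convergence of [B_k] concerns one fixed argument at a time, whereas [y_k] moves with k;
    this is the obstacle that calls for uniform boundedness. On the side of the differential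
    equation one fixed argument is enough: the source term of the equation for [z_k] is the defect
    of [L_k] at [y], and [y] does not depend on k. What must be uniform in k there is the stability
    constant, so the estimates for the Cauchy problem fix their constant before the coefficient
    matrix, of which they know only a bound K on the norms of the entries. Two encodings shape the
    rest. Functions are complex-valued on the type of points of [a, b], while real calculus is about
    functions on the line; real parts of suitable complex multiples, extended to the line, link the
    two. The norms take their values in [R[i]], so inequalities are proved for their real
    counterparts [Cnorm] and [Cvec_rnorm]. *)

Section clamp.
Context {R : realType} {a b : R} (hab : a < b).
Implicit Types (x : seg a b -> R[i]) (t s : seg a b) (r : R).

Lemma seg_itv t : a <= \val t <= b.
Proof. by have /set_mem /= := valP t; rewrite in_itv. Qed.

Fact clamp_subproof r : Num.max a (Num.min b r) \in `[a, b]%classic.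
Proof.
by rewrite inE /= in_itv /= le_max lexx /= ge_max ge_min lexx (ltW hab).
Qed.

Definition clamp r : seg a b := exist _ (Num.max a (Num.min b r)) (clamp_subproof r).

Lemma val_clamp r : a <= r <= b -> \val (clamp r) = r.
Proof. by case/andP=> ar rb /=; rewrite (min_r rb) (max_r ar). Qed.

Lemma clampK t : clamp (\val t) = t.
Proof. by apply: val_inj; rewrite val_clamp // seg_itv. Qed.

Lemma Re_continuous : continuous (@complex.Re R : R[i] -> R).
Proof.
move=> z; apply/cvgrPdist_lt => e e0.
have e0' : 0 < e%:C :> R[i] by rewrite ltcR.
apply: filterS (nbhsx_ballx z _ e0') => w /=; rewrite -ball_normE /= => zw.
rewrite -ltcR; apply: le_lt_trans zw.
have -> : complex.Re z - complex.Re w = complex.Re (z - w) by case: z; case: w.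
rewrite [leRHS]normC_Re lecR; case: (z - w) => u v /=.
by rewrite -sqrtr_sqr ler_wsqrtr // lerDl sqr_ge0.
Qed.

(* Continued by constants outside [a, b], the real part of a function on    *)
(* [a, b] is in the scope of the mean value theorem of the library.          *)
Definition ext x r : R := complex.Re (x (clamp r)).

Lemma clamp_continuous : continuous clamp.
Proof.
apply/continuous_comp_initial => r.
apply: (@continuous_comp _ _ _ (fun r => Num.min b r) (fun r => Num.max a r)).
  by apply: continuous_min; [exact: cvg_cst|exact: cvg_id].
by apply: continuous_max; [exact: cvg_cst|exact: cvg_id].
Qed.

Lemma ext_continuous x : continuous x -> continuous (ext x).
Proof.
move=> cx r; apply: (@continuous_comp _ _ _ (x \o clamp)); last exact: Re_continuous.
by apply: continuous_comp; [exact: clamp_continuous|exact: cx].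
Qed.

(** Near an interior point [clamp] is the identity, so the real difference quotient of [ext x] is
    the real part of [quot x t] along [h |-> clamp (h + t)]. This map sends the punctured
    neighbourhoods of 0 to punctured neighbourhoods of [t], where the limit of [quot x t] is
    known. *)
Lemma is_derive_ext x t : derivable_at x t -> a < \val t < b ->
  is_derive (\val t) 1 (ext x) (complex.Re (cderive x t)).
Proof.
move=> dx /andP[at_ tb].
have clE : \forall h \near (0 : R)^', \val (clamp (h + \val t)) = h + \val t.
  have m0 : 0 < Num.min (\val t - a) (b - \val t) by rewrite lt_min !subr_gt0 at_ tb.
  apply: filterS (dnbhs0_lt m0) => h.
  rewrite lt_min !ltr_norml => /andP[/andP[h1 _] /andP[_ h2]].
  apply: val_clamp.
  by apply/andP; split; lra.
have cl : clamp (h + \val t) @[h --> (0 : R)^'] --> t^'.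
  move=> U tU; have {}tU : \forall s \near t, s != t -> U s by [].
  have : \forall h \near (0 : R), clamp (h + \val t) != t -> U (clamp (h + \val t)).
    have ch : clamp (h + \val t) @[h --> (0 : R)] --> t.
      rewrite -[X in _ --> X]clampK -[X in _ --> clamp X](add0r (\val t)).
      apply: (@continuous_comp _ _ _ (fun h => h + \val t) clamp).
        by apply: cvgD; [exact: cvg_id|exact: cvg_cst].
      exact: clamp_continuous.
    exact: ch tU.
  move=> /nbhs_dnbhs tU'.
  suff : \forall h \near (0 : R)^', U (clamp (h + \val t)) by [].
  have n0 : \forall h \near (0 : R)^', h != 0 by exact: nbhs_dnbhs_neq.
  have {}tU' : \forall h \near (0 : R)^', clamp (h + \val t) != t -> U (clamp (h + \val t)) by exact: tU'.
  near=> h.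
  have hU : clamp (h + \val t) != t -> U (clamp (h + \val t)) by near: h.
  have hE : \val (clamp (h + \val t)) = h + \val t by near: h.
  have h0 : h != 0 by near: h.

  apply: hU; apply/eqP => e; have : \val t = h + \val t by rewrite -{1}e.
  by move=> /esym/eqP; rewrite -subr_eq0 addrK (negbTE h0).
have key : (fun h => h^-1 *: (ext x (h + \val t) - ext x (\val t))) @ (0 : R)^'
    --> complex.Re (cderive x t).
  have qc : (quot x t \o (fun h => clamp (h + \val t))) @ (0 : R)^' --> cderive x t.
    exact: cvg_comp cl (derivable_cvg dx).
  have := cvg_comp _ _ qc (@Re_continuous (cderive x t)).
  apply: cvg_trans; apply: near_eq_cvg; apply: filterS clE => h hE.
  rewrite /= /quot hE addrK /ext clampK.
  case: (x (clamp _)) => u v; case: (x t) => u' v'; rewrite -fmorphV /=.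
  by rewrite mulr0 subr0 mulrC.
have E : (fun h => h^-1 *: (ext x (h *: 1 + \val t) - ext x (\val t))) =
    (fun h => h^-1 *: (ext x (h + \val t) - ext x (\val t))).
  by apply/funext => h; rewrite /GRing.scale /= mulr1.
apply: DeriveDef; first by rewrite /derivable /= E; apply/cvg_ex; exists (complex.Re (cderive x t)).
rewrite /derive E; apply: cvg_lim => //.
Unshelve. all: by end_near. Qed.

End clamp.

(** * The mean value inequality for complex-valued functions *)

Section mean_value.
Context {R : realType} {a b : R} (hab : a < b).
Implicit Types (x : seg a b -> R[i]) (t s : seg a b) (r : R).

Lemma norm_Re_le (z : R[i]) : `|complex.Re z| <= complex.Re `|z|.
Proof. by case: z => u v /=; rewrite -sqrtr_sqr ler_wsqrtr // lerDl sqr_ge0. Qed.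

Lemma norm_Im_le (z : R[i]) : `|complex.Im z| <= complex.Re `|z|.
Proof. by case: z => u v /=; rewrite -sqrtr_sqr ler_wsqrtr // lerDr sqr_ge0. Qed.

Lemma Re_norm_le (z : R[i]) : complex.Re `|z| <= `|complex.Re z| + `|complex.Im z|.
Proof.
case: z => u v /=; rewrite -[leRHS]ger0_norm ?addr_ge0 // -[leRHS]sqrtr_sqr.
rewrite ler_wsqrtr // sqrrD !real_normK ?num_real // -addrA lerD2l addrC lerDl.
by rewrite mulrn_wge0 // mulr_ge0.
Qed.

Lemma ReB (z w : R[i]) : complex.Re (z - w) = complex.Re z - complex.Re w.
Proof. by case: z; case: w. Qed.

Lemma Re_conjM (z : R[i]) : complex.Re (z^* * z) = complex.Re `|z| ^+ 2.
Proof. by case: z => u v /=; rewrite sqr_sqrtr ?addr_ge0 ?sqr_ge0 //; ring. Qed.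

Lemma Re_norm_conj (z : R[i]) : complex.Re `|z^*| = complex.Re `|z|.
Proof. by case: z => u v /=; rewrite sqrrN. Qed.

(** Complex-valued functions satisfy no mean value equality. The increment d is therefore tested
    against its own direction, which gives |d|^2 <= |d| M |t - s|, and |d| is cancelled when it is
    not 0. *)
Lemma mean_value_le x (M : R) : (forall t, derivable_at x t) ->
  (forall t, a < \val t < b -> complex.Re `|cderive x t| <= M) ->
  forall s t, complex.Re `|x t - x s| <= M * `|\val t - \val s|.
Proof.
move=> dx xM; suff H s t : \val s < \val t ->
    complex.Re `|x t - x s| <= M * `|\val t - \val s|.
  move=> s t; have [st|ts|/val_inj ->] := ltgtP (\val s) (\val t); first exact: H.
    by rewrite (distrC (x t)) (distrC (\val t)); exact: H.
  by rewrite !subrr !normr0 mulr0.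
(* Re (d^* x) increases from s to t by |d|^2: MVT applies to this function. *)
move=> st; set d : R[i] := x t - x s.
suff : complex.Re `|d| <= M * `|\val t - \val s| by [].
have dy (r : seg a b) := Defs.derivableZ hab (d^*) (dx r).
have [sa sb] := andP (seg_itv s); have [ta tb] := andP (seg_itv t).
have inI r : \val s < r < \val t -> a < r < b.
  by move=> /andP[sr rt]; rewrite (le_lt_trans sa sr) (lt_le_trans rt tb).
have valI r : \val s < r < \val t -> \val (clamp hab r) = r.
  by move=> /inI/andP[ar rb]; rewrite val_clamp // !ltW.
have [||c] := @MVT _ (ext hab (d^* *: x))
    (fun r => complex.Re (cderive (d^* *: x) (clamp hab r))) _ _ st.
- move=> r; rewrite in_itv /= => str.
  rewrite -{1}(valI _ str); apply: is_derive_ext; first exact: (dy _).1.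
  by rewrite valI // inI.
- apply: continuous_subspaceT; apply: ext_continuous => r.
  by apply: (Defs.derivable_continuous hab); exact: (dy _).1.
move=> cI E0; have {cI} stc : \val s < c < \val t by move: cI; rewrite in_itv.
have {E0} E : complex.Re `|d| ^+ 2 =
    complex.Re (d^* * cderive x (clamp hab c)) * (\val t - \val s).
  rewrite -Re_conjM -(dy _).2 -E0 /ext !clampK -ReB; congr complex.Re.
  by rewrite mulrBr.
have D0 := @Re_norm_ge0 _ d.
have M0 : complex.Re `|cderive x (clamp hab c)| <= M by apply: xM; rewrite valI // inI.
have M1 := le_trans (Re_norm_ge0 _) M0.
have : complex.Re `|d| ^+ 2 <= complex.Re `|d| * (M * (\val t - \val s)).
  rewrite E mulrA ler_wpM2r ?subr_ge0 ?(ltW st) //.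
  apply: le_trans (ler_norm _) _; apply: le_trans (norm_Re_le _) _.
  by rewrite Re_normM Re_norm_conj ler_wpM2l.
have -> : `|\val t - \val s| = \val t - \val s by rewrite gtr0_norm ?subr_gt0.
rewrite expr2.
have [d0|d0] := eqVneq (complex.Re `|d|) 0.
  by move=> _; rewrite d0 mulr_ge0 // subr_ge0 ltW.
by rewrite ler_pM2l // lt_neqAle eq_sym d0.
Qed.

End mean_value.

(** * Gronwall's inequality for finite real systems *)

Section gronwall.
Context {R : realType} {I : finType}.

Lemma is_derive_bigsum (h : I -> R -> R) (dh : I -> R) (r : R) :
  (forall i, is_derive r 1 (h i) (dh i)) ->
  is_derive r 1 (\sum_i h i) (\sum_i dh i).
Proof.
move=> dr; elim/big_ind2 : _ => // [|f df g dg Df Dg]; first exact: is_derive_cst.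
exact: is_deriveD.
Qed.

Lemma is_derive_expRM (L r : R) :
  is_derive r 1 (fun s => expR (L * s)) (L * expR (L * r)).
Proof.
have d1 : is_derive r 1 (fun s => L * s) L.
  have := @is_deriveZ _ _ _ (@id R) L r 1 1 _.
  by rewrite /GRing.scale /= mulr1; apply.
have := @is_derive1_comp R expR (fun s => L * s) r (expR (L * r)) L (is_derive_expR _) d1.
by rewrite mulrC.
Qed.

(** The left side is the derivative of P, the sum of the squares. With S the sum of the |f i| and p
    the number of indices, it is at most 2 (K S + d) S. Cauchy-Schwarz gives S^2 <= p P, and 2 d S
    <= p d^2 + P comes from (d - |f i|)^2 >= 0; hence the coefficient 2 K p + 1. *)
Lemma sqr_ineq (f df : I -> R) (K d : R) : 0 <= K ->
  (forall i, `|df i| <= K * \sum_j `|f j| + d) ->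
  \sum_i (f i * df i + f i * df i) <=
    (2 * K * #|I|%:R + 1) * \sum_i (f i * f i) + #|I|%:R * d ^+ 2.
Proof.
move=> K0 fK.
set S := \sum_j `|f j|; set P := \sum_i (f i * f i); set p : R := #|I|%:R.
have SP : S * S <= p * P.
  have -> : S * S = \sum_i \sum_j `|f i| * `|f j|.
    by rewrite mulr_suml; apply: eq_bigr => i _; rewrite mulr_sumr.
  have -> : p * P = \sum_i \sum_j (f i * f i + f j * f j) / 2.
    have sumc (c : R) : \sum_(i : I) c = p * c by rewrite sumr_const -mulr_natl.
    have in_ i : \sum_j (f i * f i + f j * f j) / 2 = (p * (f i * f i) + P) / 2.
      by rewrite -mulr_suml big_split /= sumc.
    rewrite (eq_bigr _ (fun i _ => in_ i)) -mulr_suml big_split /= sumc -mulr_sumr.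
    by rewrite -/P mulrDl -splitr.
  apply: ler_sum => i _; apply: ler_sum => j _.
  rewrite -subr_ge0 -[f i * f i]expr2 -[f j * f j]expr2 -(real_normK (num_real (f i))) -(real_normK (num_real (f j))).
  have : 0 <= (`|f i| - `|f j|) ^+ 2 by exact: sqr_ge0.
  lra.
have SdP : 2 * (d * S) <= p * d ^+ 2 + P.
  rewrite /S !mulr_sumr /P; have -> : p * d ^+ 2 = \sum_(i : I) d ^+ 2.
    by rewrite sumr_const -mulr_natl.
  rewrite -big_split /=; apply: ler_sum => i _.
  rewrite -[f i * f i]expr2 -(real_normK (num_real (f i))).
  have : 0 <= (d - `|f i|) ^+ 2 by exact: sqr_ge0.
  lra.
have : \sum_i (f i * df i + f i * df i) <= \sum_i (2 * (K * S + d) * `|f i|).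
  apply: ler_sum => i _.
  have : f i * df i <= `|f i| * (K * S + d).
    apply: le_trans (ler_norm _) _; rewrite normrM; exact: ler_wpM2l.
  lra.
rewrite -mulr_sumr -/S => /le_trans; apply.
have : K * (S * S) <= K * (p * P) by exact: ler_wpM2l.
lra.
Qed.

(** Absolute values are not differentiable at 0, so the argument runs on the sum of the squares;
    this is the origin of the square root. The factor of [|d|] involves only [K], the number of
    functions and [b - a]. *)
Lemma gronwall (a b K d : R) (f df : I -> R -> R) : a < b -> 0 <= K ->
  (forall i, continuous (f i)) ->
  (forall i r, a < r < b -> is_derive r 1 (f i) (df i r)) ->
  (forall i r, a < r < b -> `|df i r| <= K * \sum_j `|f j r| + d) ->
  (forall i, f i a = 0) ->
  forall i r, a <= r <= b ->
  `|f i r| <= Num.sqrt (#|I|%:R * (b - a) *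
    expR ((2 * K * #|I|%:R + 1) * (b - a))) * `|d|.
Proof.
move=> ab K0 cf Df dfK fa i r /andP[ar rb].
pose p : R := #|I|%:R; pose L := 2 * K * p + 1.
pose phi : R -> R := \sum_j (f j * f j).
have phiE s : phi s = \sum_j (f j s * f j s) by rewrite /phi fct_sumE.
have L0 : 0 <= L by rewrite /L /p addr_ge0 // !mulr_ge0.
have p0 : 0 <= p by rewrite /p.
have Dphi s : a < s < b ->
    is_derive s 1 phi (\sum_j (f j s * df j s + f j s * df j s)).
  move=> sab; apply: is_derive_bigsum => j.
  by apply: is_deriveM; exact: Df.
(* With [phi' <= L phi + p d^2], the derivative of [phi(s) exp(- L s)] is at  *)
(* most [p d^2 exp(- L s)].                                                  *)
pose g : R -> R := phi * (fun s => expR (- L * s)).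
pose dg s := phi s *: (- L * expR (- L * s)) +
   expR (- L * s) *: (\sum_j (f j s * df j s + f j s * df j s)).
have Dg s : a < s < b -> is_derive s 1 g (dg s).
  by move=> sab; apply: is_deriveM; [exact: Dphi|exact: is_derive_expRM].
have cphi : continuous phi.
  move=> s; rewrite /phi; elim/big_ind : _ => [|u v cu cv|j _].
  - exact: cvg_cst.
  - exact: (@cvgD _ _ _ _ _ _ _ _ _ cu cv).
  - exact: (@cvgM _ _ _ _ _ _ _ _ (cf j s) (cf j s)).
have cE : continuous (fun s => expR (- L * s)).
  move=> s; apply: (@continuous_comp _ _ _ (fun s => - L * s) expR); last exact: continuous_expR.
  exact: mulrl_continuous.
have cg : continuous g.
  by move=> s; exact: (@cvgM _ _ _ _ _ _ _ _ (cphi s) (cE s)).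
have ga : g a = 0 by rewrite /g fctE phiE big1 ?mul0r // => j _; rewrite fa mul0r.
have phir : phi r <= p * (b - a) * expR (L * (b - a)) * d ^+ 2.
  have pd0 : 0 <= p * d ^+ 2 by rewrite mulr_ge0 ?sqr_ge0.
  have C0 : 0 <= p * (b - a) * expR (L * (b - a)) * d ^+ 2.
  have ba0 : 0 <= b - a by rewrite subr_ge0 ltW.
    by rewrite mulr_ge0 ?sqr_ge0 // !mulr_ge0 ?expR_ge0.
  have [->|ra] := eqVneq r a.
    by rewrite phiE big1 // => j _; rewrite fa mul0r.
  have {ra}ar' : a < r by rewrite lt_neqAle eq_sym ra.
  have [||c] := @MVT R g dg a r ar'.
  - by move=> s; rewrite in_itv /= => /andP[s1 s2]; apply: Dg; rewrite s1 (lt_le_trans s2).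
  - exact: continuous_subspaceT.
  rewrite in_itv /= => /andP[c1 c2]; rewrite ga subr0 => gE.
  have cab : a < c < b by rewrite c1 (lt_le_trans c2).
  have dgc : dg c <= p * d ^+ 2 * expR (- L * a).
    have -> : dg c = expR (- L * c) *
        (\sum_j (f j c * df j c + f j c * df j c) - L * phi c).
      by rewrite /dg /GRing.scale /=; ring.
    apply: (@le_trans _ _ (expR (- L * c) * (p * d ^+ 2))).
      rewrite ler_wpM2l ?expR_ge0 // lerBlDl phiE.
      exact: (@sqr_ineq (f ^~ c) (df ^~ c) K d K0 (fun j => dfK j c cab)).
    rewrite mulrC ler_wpM2l ?pd0 // ler_expR !mulNr lerN2.
    by rewrite ler_wpM2l // ltW.
  have -> : phi r = g r * expR (L * r).
    by rewrite /g fctE -mulrA -expRD mulNr addNr expR0 mulr1.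
  rewrite gE.
  apply: (@le_trans _ _ (p * d ^+ 2 * expR (- L * a) * (r - a) * expR (L * r))).
    by rewrite ler_wpM2r ?expR_ge0 // ler_wpM2r // subr_ge0.
  have -> : p * d ^+ 2 * expR (- L * a) * (r - a) * expR (L * r) =
      p * d ^+ 2 * ((r - a) * expR (L * (r - a))).
    have -> : expR (L * (r - a)) = expR (- L * a) * expR (L * r).
      by rewrite -expRD; congr expR; ring.
    by ring.
  have -> : p * (b - a) * expR (L * (b - a)) * d ^+ 2 =
      p * d ^+ 2 * ((b - a) * expR (L * (b - a))) by ring.
  rewrite ler_wpM2l ?pd0 // ler_pM ?expR_ge0 ?subr_ge0 ?lerB //.
  by rewrite ler_expR ler_wpM2l // lerB.
have fphi : f i r ^+ 2 <= phi r.
  rewrite phiE (bigD1 i) //= -expr2 lerDl sumr_ge0 // => j _.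
  by rewrite -expr2 sqr_ge0.
rewrite -(sqrtr_sqr (f i r)) -(sqrtr_sqr d) -sqrtrM.
  by rewrite ler_wsqrtr //; exact: le_trans fphi phir.
by rewrite !mulr_ge0 ?expR_ge0 // subr_ge0 ltW.
Qed.
End gronwall.

(** * The spaces C^n *)

Section Cnorm.
Context {R : realType} {a b : R} (hab : a < b).
Implicit Types x y : seg a b -> R[i].

Lemma Cnorm0E x : Cnorm 0 x = supnorm x.
Proof. by rewrite /Cnorm big_ord_recl big_ord0 addr0. Qed.

Lemma CnormSE n x : Cnorm n.+1 x = supnorm x + Cnorm n (cderive x).
Proof.
rewrite /Cnorm big_ord_recl; congr (_ + _); apply: eq_bigr => j _.
by rewrite /= -iterS iterSr.
Qed.

Lemma supnorm_le_Cnorm n x : Cdiff n x -> supnorm x <= Cnorm n x.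
Proof.
case: n => [|n] Cx; first by rewrite Cnorm0E.
by rewrite CnormSE lerDl (Cnorm_ge0 hab) //; case: Cx.
Qed.

Lemma le_Cnorm n x t : Cdiff n x -> complex.Re `|x t| <= Cnorm n x.
Proof.
move=> Cx; apply: le_trans (supnorm_le_Cnorm Cx).
by apply: (supnorm_ub hab); apply: (Cdiff_continuous hab Cx).
Qed.

Lemma Cnorm_cderive_le n x : Cdiff n.+1 x -> Cnorm n (cderive x) <= Cnorm n.+1 x.
Proof.
move=> Cx; rewrite CnormSE lerDr; apply: (supnorm_ge0 hab).
exact: (Cdiff_continuous hab Cx).
Qed.

Lemma Cnorm_leS n x : Cdiff n.+1 x -> Cnorm n x <= Cnorm n.+1 x.
Proof.
elim: n x => [|n IH] x Cx.
  by rewrite Cnorm0E; apply: supnorm_le_Cnorm.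
by rewrite !(CnormSE _ x) lerD2l IH //; case: Cx.
Qed.

Lemma Cnorm_le_mono j n x : (j <= n)%N -> Cdiff n x -> Cdiff j x /\ Cnorm j x <= Cnorm n x.
Proof.
elim: n => [|n IH]; first by rewrite leqn0 => /eqP ->.
rewrite leq_eqVlt => /predU1P[-> //|jn] Cx.
have [Cj le] := IH jn (CdiffS hab Cx); split=> //.
exact: le_trans le (Cnorm_leS Cx).
Qed.

Lemma CnormN n x : Cdiff n x -> Cnorm n (- x) = Cnorm n x.
Proof.
by move=> Cx; rewrite -scaleN1r (CnormZ hab) // normrN1 mul1r.
Qed.

Lemma CdiffN n x : Cdiff n x -> Cdiff n (- x).
Proof. by move=> Cx; rewrite -scaleN1r; apply: (CdiffZ hab). Qed.

Lemma CnormB n x y : Cdiff n x -> Cdiff n y -> Cnorm n (x - y) <= Cnorm n x + Cnorm n y.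
Proof.
move=> Cx Cy; rewrite -(CnormN Cy); apply: (CnormD hab) => //; exact: CdiffN.
Qed.

Lemma Cnorm_sum n (I : finType) (F : I -> seg a b -> R[i]) :
  (forall i, Cdiff n (F i)) ->
  Cdiff n (\sum_i F i) /\ Cnorm n (\sum_i F i) <= \sum_i Cnorm n (F i).
Proof.
move=> CF; elim/big_ind2 : _ => [|x r y s [Cx xr] [Cy ys]|i _]; last by [].
  split; first exact: Cdiff0.
  by have := CnormZ hab 0 (Cdiff0 hab n); rewrite scale0r normr0 mul0r => ->.
split; first exact: (CdiffD hab).
by apply: le_trans (CnormD hab Cx Cy) _; exact: lerD.
Qed.

Lemma supnormM x y : continuous x -> continuous y ->
  supnorm (x * y) <= supnorm x * supnorm y.
Proof.
move=> cx cy; apply: (supnorm_le hab) => t; rewrite Re_normM.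
by apply: ler_pM; rewrite ?Re_norm_ge0 //; exact: (supnorm_ub hab).
Qed.

Lemma cderiveM n x y : Cdiff n.+1 x -> Cdiff n.+1 y ->
  cderive (x * y) = cderive x * y + x * cderive y.
Proof.
move=> [dx _] [dy _]; apply/funext => t.
by have [] := Defs.derivableM hab (dx t) (dy t).
Qed.

(** By the Leibniz rule: the supremum of the product costs 1 and each of the two products in its
    derivative costs [C], so one more derivative turns [C] into 1 + 2 C. *)
Lemma CnormM n : exists2 C : R, 0 <= C & forall x y, Cdiff n x -> Cdiff n y ->
  Cnorm n (x * y) <= C * (Cnorm n x * Cnorm n y).
Proof.
elim: n => [|n [C C0 IH]].
  exists 1 => [|x y Cx Cy]; first exact: ler01.
  rewrite (Cnorm0E (x * y)) (Cnorm0E x) (Cnorm0E y) [leRHS]mul1r.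
  by apply: supnormM; [exact: Cx|exact: Cy].
exists (1 + (C + C)) => [|x y Cx Cy]; first by rewrite !addr_ge0.
rewrite CnormSE (cderiveM Cx Cy).
have [[_ Dx] [_ Dy]] := (Cx, Cy).
have [Cx' Cy'] := (CdiffS hab Cx, CdiffS hab Cy).
have X0 := Cnorm_ge0 hab Cx; have Y0 := Cnorm_ge0 hab Cy.
rewrite mulrDl mul1r lerD //.
  apply: le_trans (supnormM _ _) _; [exact: (Cdiff_continuous hab Cx)|exact: (Cdiff_continuous hab Cy)|].
  by apply: ler_pM; try exact: supnorm_le_Cnorm;
    apply: (supnorm_ge0 hab); [exact: (Cdiff_continuous hab Cx)|exact: (Cdiff_continuous hab Cy)].
apply: le_trans (CnormD hab _ _) _; [exact: CdiffM|exact: CdiffM|].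
rewrite mulrDl lerD //; (apply: le_trans (IH _ _ _ _) _; [by []|by []|]);
  apply: ler_wpM2l => //; apply: ler_pM; rewrite ?(Cnorm_ge0 hab) ?Cnorm_cderive_le ?Cnorm_leS //.
Qed.

(** [matrix_cauchy] imposes the equation between the end points only; continuity extends it to
    [a, b], where it becomes an equality in C^n. *)
Lemma seg_interior_dense x : continuous x ->
  (forall t, a < \val t < b -> x t = 0) -> x = 0.
Proof.
move=> cx x0; apply/funext => t.
have [tab|/negP tab] := boolP (a < \val t < b); first exact: x0.
have P := seg_proper hab t.
have xt : x @ t^' --> x t by apply: seg_dnbhs_cvg; exact: cx.
have x0' : x @ t^' --> (0 : R[i]).
  (* Here [t] is an end point. A point distinct from [t] at distance less than [b - a] is neither
     end point, so [x] vanishes there. *)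
  have nt : \forall s \near t, `|\val t - \val s| < b - a.
    have ba : 0 < b - a by rewrite subr_gt0.
    move/cvgrPdist_lt : (@seg_val_continuous _ a b t); exact.
  apply: cvg_near_cst; rewrite /dnbhs near_withinE; apply: filterS nt => s st sNt.
  apply: x0; have [ta tb] := andP (seg_itv t); have [sa sb] := andP (seg_itv s).
  have sv : \val s != \val t by rewrite (inj_eq val_inj).
  have tE : (\val t == a) || (\val t == b).
    move/negP : tab; apply: contraR; rewrite negb_or => /andP[ta' tb'].
    by rewrite !lt_neqAle eq_sym ta' tb' ta tb.
  rewrite !lt_neqAle sa sb !andbT; apply/andP; split.
    apply: contraTneq st => sE; rewrite -sE -leNgt.
    have tb' : \val t = b.
      by case/orP: tE => /eqP // tE; move: sv; rewrite -sE tE eqxx.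
    by rewrite tb' ler_norm.
  apply: contraTneq st => sE; rewrite sE -leNgt.
  have ta' : \val t = a.
    by case/orP: tE => /eqP // tE; move: sv; rewrite sE tE eqxx.
  by rewrite ta' distrC ler_norm.
exact: (cvg_unique (@norm_hausdorff _ _) xt x0').
Qed.

End Cnorm.

(** * Continuous dependence for the Cauchy problem *)

Section stability.
Context {R : realType} {a b : R} (hab : a < b) (n m : nat).
Implicit Types (A : 'M[Cspace hab n]_m) (z : Cvec hab n.+1 m).

Lemma Cspace_sumE (I : finType) k (F : I -> Cspace hab k) :
  (\sum_i F i : Cspace hab k) = \sum_i (F i : seg a b -> R[i]) :> (seg a b -> R[i]).
Proof. exact: (raddf_sum (val : Cspace hab k -> (seg a b -> R[i]))). Qed.

Lemma diffopE A z i : (diffop A z i : seg a b -> R[i]) =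
  cderive (z i) + \sum_j (A i j : seg a b -> R[i]) * (z j : seg a b -> R[i]).
Proof. rewrite ffunE -(Cspace_sumE (fun j => Cmul (A i j) (z j))).
exact: (raddfD (val : Cspace hab n -> (seg a b -> R[i]))). Qed.

Lemma cderive_diffop A z i : cderive (z i) =
  (diffop A z i : seg a b -> R[i]) - \sum_j (A i j : seg a b -> R[i]) * (z j : seg a b -> R[i]).
Proof. by rewrite diffopE addrK. Qed.

Lemma Re_norm_sum (I : finType) (F : I -> R[i]) :
  complex.Re `|\sum_i F i| <= \sum_i complex.Re `|F i|.
Proof.
elim/big_ind2 : _ => [|x r y s xr ys|//]; first by rewrite normr0.
by apply: le_trans (Re_normD _ _) _; exact: lerD.
Qed.

Let D A z := \sum_i Cnorm n (diffop A z i).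

(** Gronwall's inequality for z' = L z - A z, where [D A z] bounds the source term L z and [K] the
    coefficients. *)
Lemma cauchy_supnorm_le (K : R) : 0 <= K ->
  exists2 C : R, 0 <= C & forall A z,
    (forall i j, Cnorm n (A i j) <= K) -> (forall i, z i (@seg_left _ _ _ hab) = 0) ->
    forall i t, complex.Re `|z i t| <= C * D A z.
Proof.
move=> K0.
(* The multipliers are 1 and -i: since Re (-i w) = Im w, both parts of [z i] are real parts of
   multiples of it and share one argument. *)
pose c (e : bool) : R[i] := if e then 1 else Complex 0 (-1).
set G := Num.sqrt (#|{: 'I_m * bool}|%:R * (b - a) *
    expR ((2 * K * #|{: 'I_m * bool}|%:R + 1) * (b - a))) : R.
(* The real and imaginary parts of the z_i form a real system indexed by     *)
(* 'I_m * bool.                                                              *)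
exists (G + G) => [|A z AK z0 i t]; first by rewrite addr_ge0 // sqrtr_ge0.
pose f (p : 'I_m * bool) := ext hab (c p.2 *: (z p.1 : seg a b -> R[i])).
pose df (p : 'I_m * bool) r := complex.Re (c p.2 * cderive (z p.1) (clamp hab r)).
have Cz j : Cdiff n.+1 (z j) := CspaceP (z j).
have nc e : complex.Re `|c e| = 1.
  by case: e; rewrite /c ?normr1 //= expr0n add0r sqrtr_sqr normrN1.
have cRe w : complex.Re (c true * w) = complex.Re w by rewrite mul1r.
have cIm w : complex.Re (c false * w) = complex.Im w.
  by case: w => u v; rewrite /c /= mul0r add0r mulN1r opprK.
have D0 : 0 <= D A z.
  by rewrite sumr_ge0 // => j _; apply: (Cnorm_ge0 hab); exact: CspaceP.
have zle r : complex.Re `|z i (clamp hab r)| <= `|f (i, true) r| + `|f (i, false) r|.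
  by apply: le_trans (Re_norm_le _) _; rewrite /f /ext !fctE cRe cIm.
have fle p r : a <= r <= b -> `|f p r| <= G * `|D A z|.
  apply: (@gronwall _ _ a b K (D A z) f df) => //.
  - move=> q; apply: ext_continuous; apply: (Cdiff_continuous hab (n := n.+1)).
    exact: CdiffZ.
  - move=> q s sab; have sE : \val (clamp hab s) = s by rewrite val_clamp // !ltW //; case/andP: sab.
    have [dz _] := Cz q.1.
    have [d1 d2] := Defs.derivableZ hab (c q.2) (dz (clamp hab s)).
    rewrite -{1}sE /df -d2; apply: is_derive_ext => //.
    by rewrite sE.
  - move=> q s _; set u := clamp hab s.
    apply: le_trans (norm_Re_le _) _; rewrite Re_normM nc mul1r.
    rewrite (cderive_diffop A) fctE; apply: le_trans (Re_normD _ _) _.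
    rewrite addrC normrN lerD //.
      rewrite fct_sumE; apply: le_trans (Re_norm_sum _) _.
      have -> : \sum_p `|f p s| = \sum_j (`|f (j, true) s| + `|f (j, false) s|).
        rewrite -(pair_bigA _ (fun j e => `|f (j, e) s|)) /=.
        by apply: eq_bigr => j _; rewrite big_bool.
      rewrite mulr_sumr; apply: ler_sum => j _; rewrite fctE Re_normM.
      apply: ler_pM; rewrite ?Re_norm_ge0 //.
        apply: le_trans (AK q.1 j); apply: (le_Cnorm hab); exact: CspaceP.
      by apply: le_trans (Re_norm_le _) _; rewrite /f /ext !fctE cRe cIm.
    apply: le_trans (le_Cnorm hab _ (CspaceP _)) _.
    rewrite /D (bigD1 q.1) //= lerDl sumr_ge0 // => j _.
    apply: (Cnorm_ge0 hab); exact: CspaceP.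
  - move=> q; rewrite /f /ext !fctE.
    have -> : clamp hab a = @seg_left _ _ _ hab by apply: val_inj; rewrite val_clamp // lexx ltW.
    by rewrite z0 scaler0.
rewrite -(clampK hab t); apply: le_trans (zle _) _.
have D1 : G * `|D A z| = G * D A z by rewrite ger0_norm.
by rewrite mulrDl lerD // -D1; apply: fle; exact: seg_itv.
Qed.

(* Bootstrap on k <= n+1: z' = L z - A z gains one derivative at each step.   *)
Lemma cauchy_Cnorm_le (K : R) : 0 <= K ->
  exists2 C : R, 0 <= C & forall A z,
    (forall i j, Cnorm n (A i j) <= K) -> (forall i, z i (@seg_left _ _ _ hab) = 0) ->
    forall i, Cnorm n.+1 (z i) <= C * D A z.
Proof.
move=> K0; suff H k : (k <= n.+1)%N -> exists2 C : R, 0 <= C & forall A z,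
    (forall i j, Cnorm n (A i j) <= K) -> (forall i, z i (@seg_left _ _ _ hab) = 0) ->
    forall i, Cnorm k (z i) <= C * D A z by exact: H.
have [C1 C10 HC1] := cauchy_supnorm_le K0.
elim: k => [_|k IH kn].
  by exists C1 => // A z AK z0 i; rewrite Cnorm0E; apply: (supnorm_le hab) => t; exact: HC1.
have [C2 C20 HC2] := IH (ltnW kn); have [M M0 HM] := CnormM hab k.
(* [C1] pays for the supremum of [z i], 1 for L z, and [M * (K * C2)] for each of the m products in
   A z. *)
exists (C1 + (1 + \sum_(j < m) M * (K * C2))) => [|A z AK z0 i].
  by rewrite !addr_ge0 // sumr_ge0 // => j _; rewrite !mulr_ge0.
have D0 : 0 <= D A z.
  by rewrite sumr_ge0 // => j _; apply: (Cnorm_ge0 hab); exact: CspaceP.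
have kn' : (k <= n)%N by [].
rewrite CnormSE mulrDl lerD //; first by apply: (supnorm_le hab) => t; exact: HC1.
have Ck j : Cdiff k (z j) := (Cnorm_le_mono hab (ltnW kn) (CspaceP (z j))).1.
have [CA CA'] : (forall j, Cdiff k (A i j)) /\ forall j, Cnorm k (A i j) <= K.
  split=> j; first exact: (Cnorm_le_mono hab kn' (CspaceP (A i j))).1.
  exact: le_trans (Cnorm_le_mono hab kn' (CspaceP (A i j))).2 (AK i j).
have [Cf Cf'] := Cnorm_le_mono hab kn' (CspaceP (diffop A z i)).
have [CS CS'] := @Cnorm_sum _ _ _ hab k _ (fun j => (A i j : seg a b -> R[i]) * (z j : seg a b -> R[i]))
  (fun j => CdiffM hab (CA j) (Ck j)).
rewrite (cderive_diffop A); apply: le_trans (CnormB hab Cf CS) _.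
rewrite mulrDl mul1r lerD //.
  apply: le_trans Cf' _; rewrite /D (bigD1 i) //= lerDl sumr_ge0 // => j _.
  by apply: (Cnorm_ge0 hab); exact: CspaceP.
apply: le_trans CS' _; rewrite mulr_suml; apply: ler_sum => j _.
apply: le_trans (HM _ _ (CA j) (Ck j)) _.
rewrite -!mulrA ler_wpM2l // ler_pM ?(Cnorm_ge0 hab) //; exact: HC2.
Qed.

End stability.

(** * Completeness *)

Section completeness.
Context {R : realType}.

(** The limit keeps the index [N] of the Cauchy estimate. Applied at every point of [a, b], this
    turns a rate common to all points into uniform convergence. *)
Lemma real_seq_complete (r : nat -> R) :
  (forall e, 0 < e -> exists N, forall p q, (N <= p)%N -> (N <= q)%N -> `|r p - r q| <= e) ->
  exists l, forall e N, (forall p q, (N <= p)%N -> (N <= q)%N -> `|r p - r q| <= e) ->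
    forall p, (N <= p)%N -> `|r p - l| <= e.
Proof.
move=> cr; have cvr : cvgn r.
  apply/cauchy_cvgP/cauchy_exP => e e0.
  have e20 : 0 < e / 2 by rewrite divr_gt0.
  have [N HN] := cr _ e20; exists (r N); exists N => //= k Nk.
  rewrite -ball_normE /= (le_lt_trans (HN _ _ _ Nk)) //.
  by rewrite ltr_pdivrMr // ltr_pMr // ltr1n.
exists (limn r) => e N HN p Np.
have : (fun q => `|r p - r q|) @ \oo --> `|r p - limn r|.
  by apply: cvg_norm; apply: cvgB; [exact: cvg_cst|exact: cvr].
move/cvgr_to_le; apply; exists N => //= q Nq; exact: HN.
Qed.

Lemma complex_seq_complete (c : nat -> R[i]) :
  (forall e : R, 0 < e -> exists N, forall p q, (N <= p)%N -> (N <= q)%N ->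
     complex.Re `|c p - c q| <= e) ->
  exists l, forall (e : R) N, (forall p q, (N <= p)%N -> (N <= q)%N -> complex.Re `|c p - c q| <= e) ->
    forall p, (N <= p)%N -> complex.Re `|c p - l| <= e + e.
Proof.
have ImE z w : complex.Im (z - w : R[i]) = complex.Im z - complex.Im w by case: z; case: w.
move=> cc; have [|l Hl] := @real_seq_complete (fun k => complex.Re (c k)).
  move=> e /cc[N HN]; exists N => p q Np Nq; apply: le_trans (HN _ _ Np Nq).
  by rewrite -ReB norm_Re_le.
have [|k Hk] := @real_seq_complete (fun k => complex.Im (c k)).
  move=> e /cc[N HN]; exists N => p q Np Nq; apply: le_trans (HN _ _ Np Nq).
  by rewrite -ImE norm_Im_le.
exists (Complex l k) => e N HN p Np; apply: le_trans (Re_norm_le _) _.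
rewrite ReB ImE lerD //.
  apply: (Hl _ N) => // p' q' Np' Nq'; apply: le_trans (HN _ _ Np' Nq').
  by rewrite -ReB norm_Re_le.
apply: (Hk _ N) => // p' q' Np' Nq'; apply: le_trans (HN _ _ Np' Nq').
by rewrite -ImE norm_Im_le.
Qed.

Lemma complex_gt0E (e : R[i]) : 0 < e -> e = (complex.Re e)%:C.
Proof. by case: e => u v; rewrite ltcE /= => /andP[/eqP->]. Qed.

(** The usual criterion quantifies over positive elements of [R[i]]; these are real, so a real e
    suffices. *)
Lemma cvg_complexP (T : Type) (F : set_system T) {FF : Filter F} (f : T -> R[i]) (l : R[i]) :
  f @ F --> l <-> forall e : R, 0 < e -> \forall x \near F, complex.Re `|l - f x| < e.
Proof.
split=> [/cvgrPdist_lt fl e e0|fl].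
  have e0' : 0 < e%:C :> R[i] by rewrite ltcR.
  by apply: filterS (fl _ e0') => x; rewrite [`|_|]normC_Re ltcR.
apply/cvgrPdist_lt => e e0.
have eE := complex_gt0E e0.
have e0' : 0 < complex.Re e by rewrite -ltcR -eE.
by apply: filterS (fl _ e0') => x; rewrite [`|_|]normC_Re eE ltcR.
Qed.

Context {a b : R} (hab : a < b).
Implicit Types (x : seg a b -> R[i]) (u : nat -> seg a b -> R[i]).

Lemma uniform_seq_complete u : (forall k, continuous (u k)) ->
  (forall e : R, 0 < e -> exists N, forall p q, (N <= p)%N -> (N <= q)%N ->
    supnorm (u p - u q) <= e) ->
  exists2 x, continuous x & forall e : R, 0 < e -> exists N, forall p, (N <= p)%N ->
    forall t, complex.Re `|u p t - x t| <= e.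
Proof.
move=> cu Cu.
have uC e N : (forall p q, (N <= p)%N -> (N <= q)%N -> supnorm (u p - u q) <= e) ->
    forall t p q, (N <= p)%N -> (N <= q)%N -> complex.Re `|u p t - u q t| <= e.
  move=> H t p q Np Nq; apply: le_trans (H p q Np Nq).
  apply: (@supnorm_ub _ _ _ hab (u p - u q)) => s; exact: (cvgB (cu p s) (cu q s)).
have /choice[x Hx] : forall t, exists l, forall (e : R) N,
    (forall p q, (N <= p)%N -> (N <= q)%N -> complex.Re `|u p t - u q t| <= e) ->
    forall p, (N <= p)%N -> complex.Re `|u p t - l| <= e + e.
  move=> t; apply: complex_seq_complete => e /Cu[N HN]; exists N; exact: uC.
have ux (e : R) : 0 < e -> exists N, forall p, (N <= p)%N ->
    forall t, complex.Re `|u p t - x t| <= e.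
  move=> e0; have e20 : 0 < e / 2 by rewrite divr_gt0.
  have [N HN] := Cu _ e20; exists N => p Np t.
  rewrite [leRHS]splitr; apply: (Hx t _ N) => //; exact: uC.
exists x => // t; apply/cvg_complexP => e e0.
have e40 : 0 < e / 4 by rewrite divr_gt0.
have [N HN] := ux _ e40.
have /cvg_complexP/(_ _ e40) := cu N t.
apply: filterS => s us.
have -> : x t - x s = (x t - u N t) + ((u N t - u N s) + (u N s - x s)).
  by ring.
apply: le_lt_trans (Re_normD _ _) _.
have h1 : complex.Re `|x t - u N t| <= e / 4 by rewrite distrC; exact: HN.
have h2 := Re_normD (u N t - u N s) (u N s - x s).
have h3 := HN N (leqnn N) s.
lra.
Qed.

Lemma derivable_atB x y t : derivable_at x t -> derivable_at y t ->
  derivable_at (x - y) t /\ cderive (x - y) t = cderive x t - cderive y t.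
Proof.
move=> dx dy; have [d1 e1] := Defs.derivableZ hab (-1) dy.
have [d2 e2] := Defs.derivableD hab dx d1.
by rewrite -[- y]scaleN1r; split=> //; rewrite e2 e1 mulN1r.
Qed.

(** The mean value inequality bounds the increments of [u q - u N] by (e/8 + e/8) |s - t|, and the
    bound survives as q grows. Hence the difference quotients of [x] and [u N] at [t] differ by at
    most e/4 for all s at once, and the derivative of the single function [u N] concludes. *)
Lemma uniform_derivable_lim u x g : (forall k t, derivable_at (u k) t) ->
  (forall e : R, 0 < e -> exists N, forall p, (N <= p)%N ->
    forall t, complex.Re `|u p t - x t| <= e) ->
  (forall e : R, 0 < e -> exists N, forall p, (N <= p)%N ->
    forall t, complex.Re `|cderive (u p) t - g t| <= e) ->
  forall t, derivable_at x t /\ cderive x t = g t.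
Proof.
move=> du ux ug t; apply: (derivable_eq hab); apply/cvg_complexP => e e0.
have P := seg_proper hab t.
have e40 : 0 < e / 8 by rewrite divr_gt0.
have [N HN] := ug _ e40.
have uxs s : complex.Re `|(x s - u N s) - (x t - u N t)| <= e / 4 * `|\val s - \val t|.
  apply/ler_addgt0Pr => d d0; have d20 : 0 < d / 2 by rewrite divr_gt0.
  have [N' HN'] := ux _ d20; pose q := maxn N N'.
  have -> : x s - u N s - (x t - u N t) =
     ((u q - u N) s - (u q - u N) t) + ((x s - u q s) - (x t - u q t)).
    by rewrite !fctE; ring.
  apply: le_trans (Re_normD _ _) _; apply: lerD.
    apply: (mean_value_le hab) => [r|r _].
      exact: (derivable_atB (du q r) (du N r)).1.
    rewrite (derivable_atB (du q r) (du N r)).2.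
    have -> : cderive (u q) r - cderive (u N) r =
      (cderive (u q) r - g r) - (cderive (u N) r - g r) by ring.
    apply: le_trans (Re_normD _ _) _; rewrite normrN.
    have h1 := HN q (leq_maxl _ _) r; have h2 := HN N (leqnn _) r; lra.
  apply: le_trans (Re_normD _ _) _; rewrite normrN distrC (distrC (x t)).
  have h1 := HN' q (leq_maxr _ _) s; have h2 := HN' q (leq_maxr _ _) t; lra.
have /cvg_complexP/(_ _ e40) := derivable_cvg (du N t).
have : \forall s \near t^', s != t by exact: nbhs_dnbhs_neq.
apply: filterS2 => s st qs.
have -> : g t - quot x t s = (g t - cderive (u N) t) +
   ((cderive (u N) t - quot (u N) t s) - quot (fun s => x s - u N s) t s).
  by rewrite /quot; ring.
apply: le_lt_trans (Re_normD _ _) _.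
have h1 : complex.Re `|g t - cderive (u N) t| <= e / 8 by rewrite distrC; exact: HN.
have h2 := Re_normD (cderive (u N) t - quot (u N) t s) (- quot (fun s => x s - u N s) t s).
have h3 : complex.Re `|quot (fun s => x s - u N s) t s| <= e / 4.
  have vst : 0 < `|\val s - \val t| by rewrite normr_gt0 subr_eq0 (inj_eq val_inj).
  rewrite /quot Re_normM normfV normC_real -fmorphV.
  rewrite -[X in _ * X <= _]/(`|\val s - \val t|^-1) ler_pdivrMr //.
rewrite normrN in h2.
lra.
Qed.

(** The functions converge uniformly to some x and, by induction, their derivatives converge in C^n
    to some g; then x' = g by [uniform_derivable_lim]. *)
Lemma Cseq_complete n u : (forall k, Cdiff n (u k)) ->
  (forall e : R, 0 < e -> exists N, forall p q, (N <= p)%N -> (N <= q)%N ->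
    Cnorm n (u p - u q) <= e) ->
  exists2 x, Cdiff n x & forall e : R, 0 < e -> exists N, forall p, (N <= p)%N ->
    Cnorm n (u p - x) <= e.
Proof.
elim: n u => [|n IH] u Du Cu.
  have [|x cx ux] := @uniform_seq_complete u Du.
    by move=> e /Cu[N HN]; exists N => p q Np Nq; rewrite -Cnorm0E; exact: HN.
  exists x => // e /ux[N HN]; exists N => p Np; rewrite Cnorm0E.
  by apply: (supnorm_le hab) => t; exact: HN.
have dB k y t : Cdiff n.+1 y -> cderive (u k - y) t = cderive (u k) t - cderive y t.
  by move=> [dy _]; exact: (derivable_atB ((Du k).1 t) (dy t)).2.
have dBE k y : Cdiff n.+1 y -> cderive (u k - y) = cderive (u k) - cderive y.
  by move=> Dy; apply/funext => t; exact: dB.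
have CB p y : Cdiff n.+1 y -> Cdiff n.+1 (u p - y).
  by move=> Dy; apply: (CdiffD hab) => //; exact: (CdiffN hab).
have cB p y : Cdiff n.+1 y -> continuous (u p - y).
  by move=> Dy; apply: (Cdiff_continuous hab (CB p _ Dy)).
have [||x cx ux] := @uniform_seq_complete u.
- by move=> k; exact: (Cdiff_continuous hab (Du k)).
- move=> e /Cu[N HN]; exists N => p q Np Nq; apply: le_trans (HN p q Np Nq).
  exact: (supnorm_le_Cnorm hab (CB p _ (Du q))).
have [||g Dg ug] := IH (fun k => cderive (u k)).
- by move=> k; case: (Du k).
- move=> e /Cu[N HN]; exists N => p q Np Nq; apply: le_trans (HN p q Np Nq).
  rewrite -(dBE p _ (Du q)); exact: (Cnorm_cderive_le hab (CB p _ (Du q))).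
have xg t : derivable_at x t /\ cderive x t = g t.
  apply: (uniform_derivable_lim _ ux) => [k s|e /ug[N HN]]; first exact: (Du k).1.
  exists N => p Np s; apply: le_trans (HN p Np).
  apply: (le_Cnorm hab (x := cderive (u p) - g)).
  by apply: (CdiffD hab); [case: (Du p)|exact: (CdiffN hab)].
have xE : cderive x = g by apply/funext => t; exact: (xg t).2.
have Dx : Cdiff n.+1 x by split; [move=> t; exact: (xg t).1|rewrite xE].
exists x => // e e0; have e20 : 0 < e / 2 by rewrite divr_gt0.
have [[N1 HN1] [N2 HN2]] := (ux _ e20, ug _ e20).
exists (maxn N1 N2) => p; rewrite geq_max => /andP[Np1 Np2].
rewrite CnormSE (dBE p _ Dx) xE [leRHS]splitr lerD ?HN2 //.
by apply: (supnorm_le hab) => t; exact: HN1.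
Qed.

End completeness.

(** * Uniform boundedness *)

Section uniform_boundedness.
Context {R : realType} {V : lmodType R[i]}.
Implicit Types x y : V.

(** Real-valued, so as to cover both the norm of (C^n)^m and the modulus of one entry of [B_k]. *)
Definition seminorm (p : V -> R) : Prop :=
  (forall x y, p (x + y) <= p x + p y) /\
  (forall (c : R[i]) x, p (c *: x) = complex.Re `|c| * p x).

Lemma seminorm0 p : seminorm p -> p 0 = 0.
Proof. by move=> [_ pZ]; rewrite -(scale0r 0) pZ normr0 mul0r. Qed.

Lemma seminormN p x : seminorm p -> p (- x) = p x.
Proof. by move=> [_ pZ]; rewrite -scaleN1r pZ normrN1 mul1r. Qed.

Lemma seminormZr p (r : R) x : seminorm p -> 0 <= r -> p (r%:C *: x) = r * p x.
Proof. by move=> [_ pZ] r0; rewrite pZ normC_real ger0_norm. Qed.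

Lemma seminorm_ge0 p x : seminorm p -> 0 <= p x.
Proof.
move=> sp; have := sp.1 x (- x); rewrite subrr (seminorm0 sp) (seminormN _ sp); lra.
Qed.

Lemma seminorm_dist p x y : seminorm p -> p (x - y) = p (y - x).
Proof. by move=> sp; rewrite -(seminormN _ sp) opprB. Qed.

(** The number is the operator norm of [q], a supremum over the unit ball. Any fraction below 1 of
    it is reached by some vector, and the zero vector serves when it is 0. *)
Lemma near_norming_vector (N q : V -> R) (M : R) : seminorm N -> seminorm q ->
  (forall x, q x <= M * N x) ->
  exists cx : R * V, [/\ 0 <= cx.1, forall x, q x <= cx.1 * N x, N cx.2 <= 1 &
    2 / 3 * cx.1 <= q cx.2].
Proof.
move=> sN sq qM; set S := q @` [set x | N x <= 1]; set c := sup S.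
have S0 : S 0 by exists 0; rewrite /= ?(seminorm0 sN) // (seminorm0 sq).
have ubS : has_ubound S.
  exists `|M| => _ [x /= x1 <-]; apply: le_trans (qM x) _.
  apply: le_trans (ler_norm _) _; rewrite normrM (ger0_norm (seminorm_ge0 _ sN)).
  by rewrite -[leRHS]mulr1 ler_wpM2l.
have hS : has_sup S by split=> //; exists 0.
have c0 : 0 <= c by apply: ub_le_sup.
have qc x : q x <= c * N x.
  have := seminorm_ge0 x sN; rewrite le_eqVlt => /predU1P[x0|x0].
    by have := qM x; rewrite -x0 !mulr0.
  have : q ((N x)^-1%:C *: x) <= c.
    apply: ub_le_sup => //; exists ((N x)^-1%:C *: x) => //=.
    by rewrite seminormZr // ?invr_ge0 ?(ltW x0) // mulVf // gt_eqF.
  by rewrite seminormZr // ?invr_ge0 ?(ltW x0) // mulrC ler_pdivrMr.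
have := c0; rewrite le_eqVlt => /predU1P[cE|cp].
  exists (c, 0); split=> //=; first by rewrite (seminorm0 sN).
  by rewrite -cE mulr0 (seminorm0 sq).
have c3 : 0 < c / 3 by rewrite divr_gt0.
have [_ [x /= x1 <-] cx] := sup_adherent c3 hS.
exists (c, x); split=> //=; rewrite -/c in cx; lra.
Qed.

Context (N : V -> R) (q : nat -> V -> R).
Hypothesis sN : seminorm N.
Hypothesis sq : forall k, seminorm (q k).
Hypothesis N_complete : forall u : nat -> V,
  (forall e : R, 0 < e -> exists n, forall i j, (n <= i)%N -> (n <= j)%N -> N (u i - u j) <= e) ->
  exists x, forall e : R, 0 < e -> exists n, forall i, (n <= i)%N -> N (u i - x) <= e.

Lemma uniform_boundedness :
  (forall k, exists M, forall x, q k x <= M * N x) ->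
  (forall x, exists M, forall k, q k x <= M) ->
  exists C, forall k x, q k x <= C * N x.
Proof.
move=> qN qb; apply: contrapT => unb.
have /choice[cv Hcv] : forall k, exists cx : R * V, [/\ 0 <= cx.1,
    forall x, q k x <= cx.1 * N x, N cx.2 <= 1 & 2 / 3 * cx.1 <= q k cx.2].
  by move=> k; have [M HM] := qN k; exact: near_norming_vector HM.
(* Steps of size 3^-n will be taken against norms of at least n 3^n, so the products are at least
   n. *)
have /choice[kap Hkap] : forall n, exists k, n%:R * 3 ^+ n <= (cv k).1.
  move=> n; apply: contrapT => nk; apply: unb; exists (n%:R * 3 ^+ n) => k x.
  have [c0 cq _ _] := Hcv k; apply: le_trans (cq x) _.
  rewrite ler_wpM2r ?(seminorm_ge0 _ sN) // leNgt; apply/negP => lt.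
  by apply: nk; exists k; exact: ltW.
pose t n : R := (3 ^+ n)^-1.
have t0 n : 0 < t n by rewrite invr_gt0 exprn_gt0.
have tS n : t n.+1 = t n / 3 by rewrite /t exprSr invfM mulrC.
pose eta n := (t n)%:C *: (cv (kap n)).2.
(* As [2 eta = (x + eta) - (x - eta)], one of the two choices of [step] makes *)
(* [q] at least [q eta]; the later steps, of total size [3^-n / 2], lose at   *)
(* most three quarters of the value [2/3 * 3^-n * ||q||] reached at step [n]. *)
pose step n x := if q (kap n) (eta n) <= q (kap n) (x + eta n)
  then x + eta n else x - eta n.
pose u := fix u n := if n is n'.+1 then step n' (u n') else 0.
have Neta n : N (eta n) <= t n.
  rewrite seminormZr ?(ltW (t0 n)) //; have [_ _ c1 _] := Hcv (kap n).
  by rewrite -[leRHS]mulr1 ler_wpM2l // ltW.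
have Nu n : N (u n.+1 - u n) <= t n.
  rewrite /= /step; case: ifP => _; rewrite addrC addKr ?(seminormN _ sN); exact: Neta.
have qu n : 2 / 3 * t n * (cv (kap n)).1 <= q (kap n) (u n.+1).
  have [_ _ _ c1] := Hcv (kap n).
  have qeta : 2 / 3 * t n * (cv (kap n)).1 <= q (kap n) (eta n).
    rewrite seminormZr ?(ltW (t0 n)) // -mulrA mulrCA ler_wpM2l // ltW //.
  apply: le_trans qeta _; rewrite /= /step; case: ifPn => //; rewrite -ltNge => lt.
  have := (sq (kap n)).1 (u n + eta n) (eta n - u n).
  rewrite (seminorm_dist (eta n) (u n) (sq _)).
  have -> : u n + eta n + (eta n - u n) = (2%:R : R)%:C *: eta n.
    rewrite rmorph_nat scaler_nat mulr2n [u n + _]addrC -addrA.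
    by rewrite (addrCA (u n)) subrr addr0.
  rewrite (seminormZr _ (sq _)) //; lra.
(* A geometric sum of ratio 1/3 in closed form; the limit d to infinity gives the tail bound
   [3 / 2 * t n]. *)
have Nud n d : N (u (n + d)%N - u n) <= 3 / 2 * (t n - t (n + d)%N).
  elim: d => [|d IH]; first by rewrite addn0 !subrr (seminorm0 sN) mulr0.
  rewrite addnS; have h := sN.1 (u (n + d).+1 - u (n + d)%N) (u (n + d)%N - u n).
  rewrite addrA subrK in h; apply: le_trans h _.
  have := Nu (n + d)%N; have := tS (n + d)%N; lra.
have Nup n p : (n <= p)%N -> N (u p - u n) <= 3 / 2 * t n.
  move=> np; rewrite -(subnKC np); apply: le_trans (Nud _ _) _.
  have := t0 (n + (p - n))%N; lra.
have tsmall (e : R) : 0 < e -> exists n, t n <= e.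
  move=> e0; exists (Num.truncn e^-1).+1; rewrite /t -[leRHS]invrK lef_pV2 ?posrE ?invr_gt0 ?exprn_gt0 //.
  apply: le_trans (ltW (truncnS_gt _)) _; rewrite -natrX ler_nat ltnW // ltn_expl //.
have [|x ux] := N_complete (u := u).
  move=> e e0; have e30 : 0 < e / 3 by rewrite divr_gt0.
  have [n tn] := tsmall _ e30; exists n => i j ni nj.
  have := sN.1 (u i - u n) (u n - u j); rewrite addrA subrK (seminorm_dist (u n) _ sN).
  have := Nup _ _ ni; have := Nup _ _ nj; lra.
have Nx n : N (u n - x) <= 3 / 2 * t n.
  apply/ler_addgt0Pr => e e0; have [n' Hn'] := ux _ e0.
  have h := sN.1 (u n - u (maxn n n')) (u (maxn n n') - x).
  rewrite addrA subrK (seminorm_dist (u n) (u _) sN) in h.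
  have := Nup _ _ (leq_maxl n n'); have := Hn' _ (leq_maxr n n'); lra.
have [M HM] := qb x.
(* 1/6 is 2/3 - 1/2: step n reaches 2/3 of [t n] times the norm of [q (kap n)], and the tail after
   it, at most [3 / 2 * t n.+1], that is half of [t n], takes away 1/2 of the same product. *)
have big n : n%:R / 6 <= M.
  have [c0 cq _ _] := Hcv (kap n).
  have h := (sq (kap n)).1 (u n.+1 - x) x; rewrite subrK in h.
  have h1 := cq (u n.+1 - x); have h2 := Nx n.+1; have h3 := HM (kap n).
  have h4 : (cv (kap n)).1 * N (u n.+1 - x) <= (cv (kap n)).1 * (3 / 2 * t n.+1) by rewrite ler_wpM2l.
  have h5 : n%:R <= t n * (cv (kap n)).1.
    by rewrite mulrC ler_pdivlMr ?exprn_gt0 //; exact: Hkap.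
  have h6 := qu n; rewrite tS in h4.
  have h7 : (cv (kap n)).1 * (3 / 2 * (t n / 3)) = 1 / 2 * (t n * (cv (kap n)).1) by field.
  have h8 : 2 / 3 * t n * (cv (kap n)).1 = 2 / 3 * (t n * (cv (kap n)).1) by rewrite mulrA.
  lra.
have := big (Num.truncn (6 * M)).+1; have := truncnS_gt (6 * M); lra.
Qed.

End uniform_boundedness.

(** * The spaces (C^n)^m: real norm, completeness, bounded functionals *)

Section Cvec_norm.
Context {R : realType} {a b : R} (hab : a < b).

(* The norm of (C^n)^m as a real number, the norm itself being valued in R[i]. *)
Definition Cvec_rnorm {n m} (y : Cvec hab n m) : R := \sum_i Cnorm n (y i).

Lemma Cvec_normE n m (y : Cvec hab n m) : `|y| = (Cvec_rnorm y)%:C.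
Proof. by rewrite rmorph_sum. Qed.

Lemma Cvec_rnorm_seminorm n m : seminorm (@Cvec_rnorm n m).
Proof.
split=> [x y|c x]; first by have := ler_normD x y; rewrite !Cvec_normE -rmorphD lecR.
by have := normrZ c x; rewrite !Cvec_normE [X in X * _]normC_Re -rmorphM => /complexI.
Qed.

Lemma Cspace_subE n (x y : Cspace hab n) :
  (x - y : Cspace hab n) = (x : seg a b -> R[i]) - (y : seg a b -> R[i]) :> (seg a b -> R[i]).
Proof. exact: (raddfB (val : Cspace hab n -> (seg a b -> R[i]))). Qed.

Lemma Cvec_subE n m (x y : Cvec hab n m) i :
  ((x - y) i : seg a b -> R[i]) = (x i : seg a b -> R[i]) - (y i : seg a b -> R[i]).
Proof. by rewrite !ffunE -Cspace_subE. Qed.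

Lemma le_Cvec_rnorm n m (y : Cvec hab n m) i : Cnorm n (y i) <= Cvec_rnorm y.
Proof.
rewrite /Cvec_rnorm (bigD1 i) //= lerDl sumr_ge0 // => j _.
by apply: (Cnorm_ge0 hab); exact: CspaceP.
Qed.

Lemma Cvec_complete n m (u : nat -> Cvec hab n m) :
  (forall e : R, 0 < e -> exists N, forall p q, (N <= p)%N -> (N <= q)%N ->
    Cvec_rnorm (u p - u q) <= e) ->
  exists x, forall e : R, 0 < e -> exists N, forall p, (N <= p)%N ->
    Cvec_rnorm (u p - x) <= e.
Proof.
move=> Cu.
have /choice[x Hx] : forall i : 'I_m, exists x : Cspace hab n, forall e : R, 0 < e ->
    exists N, forall p, (N <= p)%N -> Cnorm n ((u p i : seg a b -> R[i]) - (x : seg a b -> R[i])) <= e.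
  move=> i; have [||x Dx ux] := @Cseq_complete _ _ _ hab n (fun k => u k i).
  - by move=> k; exact: CspaceP.
  - move=> e /Cu[N HN]; exists N => p q Np Nq; apply: le_trans (HN p q Np Nq).
    by rewrite -Cvec_subE; exact: le_Cvec_rnorm.
  have Px : x \in Cpred hab n by apply/asboolP.
  by exists (MkCspace Px).
exists [ffun i => x i] => e e0.
(* Dividing by m + 1 rather than m covers m = 0. *)
have em0 : 0 < e / m.+1%:R by rewrite divr_gt0.
have /choice[M HM] := fun i => Hx i _ em0.
exists (\max_i M i)%N => p Mp; rewrite /Cvec_rnorm.
apply: (@le_trans _ _ (\sum_(i < m) e / m.+1%:R)).
  apply: ler_sum => i _; rewrite Cvec_subE ffunE; apply: HM.
  by apply: leq_trans Mp; exact: leq_bigmax.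
rewrite sumr_const card_ord -(mulr_natl (e / m.+1%:R) m) mulrCA -[leRHS]mulr1 ler_wpM2l ?(ltW e0) //.
by rewrite ler_pdivrMr // mul1r ler_nat.
Qed.

Lemma continuous_scalable_le n m (f : Cvec hab n m -> R[i]) :
  (forall c y, f (c *: y) = c * f y) -> continuous f ->
  exists M, forall y, complex.Re `|f y| <= M * Cvec_rnorm y.
Proof.
move=> fZ cf; have f0 : f 0 = 0 by rewrite -(scale0r 0) fZ mul0r.
have /cvg_complexP/(_ _ ltr01) := cf 0; rewrite f0.
move=> /nbhs_normP[d d0' Hd]; have {d0'} d0 : 0 < d := d0'.
have dE := complex_gt0E d0.
have d0' : 0 < complex.Re d by rewrite -ltcR -dE.
(* Half the radius of a ball on which |f| < 1: a vector rescaled to norm r lies strictly inside. *)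
set r := complex.Re d / 2; have r0 : 0 < r by rewrite divr_gt0.
exists r^-1 => y.
have sN := Cvec_rnorm_seminorm n m.
have := seminorm_ge0 y sN; rewrite le_eqVlt => /predU1P[y0|y0].
  suff -> : y = 0 by rewrite f0 normr0 (seminorm0 sN) mulr0.
  by apply/normr0_eq0; rewrite Cvec_normE -y0.
set s := r / Cvec_rnorm y; have s0 : 0 < s by rewrite divr_gt0.
have h : complex.Re `|f (s%:C *: y)| < 1.
  rewrite -normrN -sub0r; apply: Hd => /=; rewrite sub0r normrN Cvec_normE.
  rewrite (seminormZr _ sN) ?(ltW s0) // /s divfK ?gt_eqF // dE ltcR /r; lra.
move: h; rewrite fZ Re_normM normC_real ger0_norm ?(ltW s0) // mulrC.
rewrite -[X in X < 1]/(complex.Re `|f y| * s) -ltr_pdivlMr // => /ltW h.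
by apply: le_trans h _; rewrite /s mul1r invf_div mulrC.
Qed.

End Cvec_norm.

(** * Characteristic matrices *)

Section characteristic_matrix.
Context {R : realType} {a b : R} (hab : a < b).

Lemma cvg_mx_coord p q (M : nat -> 'M[R[i]]_(p, q)) (L : 'M[R[i]]_(p, q)) :
  (forall i j, (fun k => M k i j) @ \oo --> L i j) -> M @ \oo --> L.
Proof.
move=> ML; apply/cvg_ballP => e e0.
have : \forall k \near \oo, forall i j, ball (L i j) e (M k i j).
  apply: filter_forall => i; apply: filter_forall => j.
  by move/cvg_ballP : (ML i j); exact.
by apply: filterS => k H; split.
Qed.

Lemma Cvec_cvgP n m (f : nat -> Cvec hab n m) (l : Cvec hab n m) :
  f @ \oo --> l <-> forall e : R, 0 < e -> \forall k \near \oo, Cvec_rnorm (l - f k) < e.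
Proof.
split=> [/cvgrPdist_lt fl e e0|fl].
  have e0' : 0 < e%:C :> R[i] by rewrite ltcR.
  by apply: filterS (fl _ e0') => k; rewrite Cvec_normE ltcR.
apply/cvgrPdist_lt => e e0.
have eE := complex_gt0E e0.
have e0' : 0 < complex.Re e by rewrite -ltcR -eE.
by apply: filterS (fl _ e0') => k; rewrite Cvec_normE eE ltcR.
Qed.

Lemma diffopB n m (A : 'M[Cspace hab n]_m) (x y : Cvec hab n.+1 m) :
  diffop A (x - y) = diffop A x - diffop A y.
Proof.
apply/ffunP => i; apply: val_inj; apply/funext => t.
have [[dx _] [dy _]] := (CspaceP (x i), CspaceP (y i)).
rewrite -[LHS]/((diffop A (x - y) i : seg a b -> R[i]) t).
rewrite -[RHS]/((((diffop A x - diffop A y) i) : seg a b -> R[i]) t).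
rewrite Cvec_subE !diffopE !fctE !fct_sumE Cvec_subE (derivable_atB hab (dx t) (dy t)).2.
under eq_bigr do rewrite Cvec_subE fctE mulrBr.
by rewrite sumrB opprD addrACA.
Qed.

Lemma matrix_cauchy_diffop n m (A : 'M[Cspace hab n]_m) Y j :
  matrix_cauchy A Y -> diffop A (Ccol Y j) = 0.
Proof.
move=> [AY _]; apply/ffunP => i; rewrite [RHS]ffunE; apply: val_inj.
apply: (seg_interior_dense hab); first exact: (Cdiff_continuous hab (CspaceP _)).
move=> t tab; rewrite -[LHS]/((diffop A (Ccol Y j) i : seg a b -> R[i]) t).
rewrite diffopE fctE fct_sumE ffunE.
have /matrixP/(_ i j) := AY t tab; rewrite !mxE; apply: etrans; congr (_ + _).
by apply: eq_bigr => k _; rewrite !mxE fctE ffunE.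
Qed.

Lemma matrix_cauchy_left n m (A : 'M[Cspace hab n]_m) Y j i :
  matrix_cauchy A Y -> Ccol Y j i (@seg_left _ _ _ hab) = (i == j)%:R.
Proof. by move=> [_ /matrixP/(_ i j)]; rewrite !mxE ffunE. Qed.

Lemma cderive_cst (c : R[i]) (t : seg a b) :
  derivable_at (cst c) t /\ cderive (cst c : seg a b -> R[i]) t = 0.
Proof.
apply: (derivable_eq hab); have -> : quot (cst c) t = cst 0.
  by apply/funext => s; rewrite /quot subrr mul0r.
exact: cvg_cst.
Qed.

Lemma cderive_cstE (c : R[i]) : cderive (cst c : seg a b -> R[i]) = 0.
Proof. by apply/funext => t; exact: (cderive_cst c t).2. Qed.

Fact cst_subproof n (c : R[i]) : (cst c : seg a b -> R[i]) \in Cpred hab n.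
Proof.
apply/asboolP; case: n => [t|n]; first exact: cvg_cst.
split=> [t|]; first exact: (cderive_cst c t).1.
by rewrite cderive_cstE; exact: Cdiff0.
Qed.

Definition Cunit n m (j : 'I_m) : Cvec hab n m :=
  [ffun i => MkCspace (cst_subproof n (i == j)%:R)].

(** The derivative of a constant vector vanishes, so L only reads off column j of [A]; convergence
    of L_k at these finitely many vectors controls all entries of A_k. *)
Lemma diffop_Cunit n m (A : 'M[Cspace hab n]_m) i j :
  diffop A (Cunit n.+1 j) i = A i j.
Proof.
apply: val_inj; rewrite -[LHS]/(diffop A (Cunit n.+1 j) i : seg a b -> R[i]) diffopE.
rewrite ffunE cderive_cstE add0r (bigD1 j) //= big1 ?addr0 => [|k kj].
  by rewrite ffunE eqxx; apply/funext => t; rewrite fctE mulr1.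
by rewrite ffunE (negbTE kj); apply/funext => t; rewrite fctE mulr0.
Qed.

End characteristic_matrix.

(* [n.+1] is the smoothness order of the domain, [n] that of A and A_k. *)
Theorem mainTheorem3 (R : realType) (a b : R) (hab : a < b) (m l n : nat)
  (hm : (0 < m)%N) (hl : (0 < l)%N)
  (A : 'M[Cspace hab n]_m) (A_ : nat -> 'M[Cspace hab n]_m)
  (B : {linear Cvec hab n.+1 m -> 'cV[R[i]]_l})
  (B_ : nat -> {linear Cvec hab n.+1 m -> 'cV[R[i]]_l})
  (B_cont : continuous B) (B__cont : forall k, continuous (B_ k))
  (Y : 'M[Cspace hab n.+1]_m) (Y_ : nat -> 'M[Cspace hab n.+1]_m)
  (Y_sol : matrix_cauchy A Y) (Y__sol : forall k, matrix_cauchy (A_ k) (Y_ k)) :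
  sot_cvg (fun k => bvp_op (A_ k) (B_ k)) (bvp_op A B) ->
  (fun k => charmx (B_ k) (Y_ k)) @ \oo --> charmx B Y.
Proof.
move=> sot.
have sotA y : (fun k => diffop (A_ k) y) @ \oo --> diffop A y.
  exact: (cvg_comp _ _ (sot y) cvg_fst).
have sotB y i : (fun k => B_ k y i 0) @ \oo --> B y i 0.
  have h : (fun k => B_ k y) @ \oo --> B y by exact: (cvg_comp _ _ (sot y) cvg_snd).
  exact: (cvg_comp _ _ h (@coord_continuous _ _ _ i 0 (B y))).
apply: cvg_mx_coord => i j; rewrite mxE.
under eq_fun do rewrite mxE.
set y := Ccol Y j; pose z k := Ccol (Y_ k) j - y.
pose q k x := complex.Re `|B_ k x i 0|.
have sN := Cvec_rnorm_seminorm hab n.+1 m.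
have sq k : seminorm (q k).
  split=> [x w|c x]; rewrite /q ?linearD ?linearZ mxE; [exact: Re_normD|exact: Re_normM].
have [C HC] : exists C, forall k x, q k x <= C * Cvec_rnorm x.
  apply: (uniform_boundedness sN sq).
  - by move=> u; exact: Cvec_complete.
  - move=> k; apply: continuous_scalable_le => [c x|x]; first by rewrite linearZ mxE.
    exact: (cvg_comp _ _ (B__cont k x) (@coord_continuous _ _ _ i 0 (B_ k x))).
  (* From index [N] on the values lie within 1 of the limit; the finitely many earlier ones are
     bounded by their sum. *)
  - move=> x; have /cvg_complexP/(_ _ ltr01)[N _ HN] := sotB x i.
    exists (complex.Re `|B x i 0| + 1 + \sum_(k < N) q k x) => k.
    have q0 k' : 0 <= q k' x by exact: Re_norm_ge0.
    have [kN|Nk] := ltnP k N.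
      rewrite (bigD1 (Ordinal kN)) //= addrCA lerDl !addr_ge0 ?Re_norm_ge0 //.
      by apply: sumr_ge0.
    have h : complex.Re `|B x i 0 - B_ k x i 0| < 1 := HN k Nk.
    have h1 := Re_normD (B x i 0) (- (B x i 0 - B_ k x i 0)).
    have e1 : B x i 0 + - (B x i 0 - B_ k x i 0) = B_ k x i 0 by ring.
    rewrite e1 normrN -/(q k x) in h1.
    have : 0 <= \sum_(k0 < N) q k0 x by exact: sumr_ge0.
    lra.
have Cn0 i0 j0 : 0 <= Cnorm n (A i0 j0) by apply: (Cnorm_ge0 hab); exact: CspaceP.
(* Each entry of A_k is eventually within 1 of that of [A] in C^n. *)
pose K := \sum_i0 \sum_j0 Cnorm n (A i0 j0) + 1.
have K0 : 0 <= K.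
  rewrite addr_ge0 // sumr_ge0 // => i0 _; by rewrite sumr_ge0.
have AK : \forall k \near \oo, forall i0 j0, Cnorm n (A_ k i0 j0) <= K.
  have : \forall k \near \oo, forall j0, Cvec_rnorm (diffop A (Cunit hab n.+1 j0) - diffop (A_ k) (Cunit hab n.+1 j0)) < 1.
    apply: filter_forall => j0; have /Cvec_cvgP := sotA (Cunit hab n.+1 j0); exact.
  apply: filterS => k Hk i0 j0.
  have h := le_lt_trans (le_Cvec_rnorm _ i0) (Hk j0).
  rewrite Cvec_subE !diffop_Cunit in h.
  have CA := CspaceP (A i0 j0); have CAk := CspaceP (A_ k i0 j0).
  have CD : Cdiff n ((A i0 j0 : seg a b -> R[i]) - (A_ k i0 j0 : seg a b -> R[i])).
    by apply: (CdiffD hab) => //; exact: (CdiffN hab).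
  have h1 := CnormB hab CA CD.
  have e1 : (A i0 j0 : seg a b -> R[i]) - ((A i0 j0 : seg a b -> R[i]) - (A_ k i0 j0 : seg a b -> R[i])) = A_ k i0 j0.
    by rewrite opprB addrC subrK.
  rewrite e1 in h1.
  have h2 : Cnorm n (A i0 j0) <= \sum_i0 \sum_j0 Cnorm n (A i0 j0).
    rewrite (bigD1 i0) //= (bigD1 j0) //= -addrA lerDl addr_ge0 ?sumr_ge0 // => *.
    by rewrite sumr_ge0.
  rewrite /K; lra.
have [S S0 HS] := @cauchy_Cnorm_le _ _ _ hab n m K K0.
pose delta k := Cvec_rnorm (diffop A y - diffop (A_ k) y).
have zle : \forall k \near \oo, q k (z k) <= `|C| * (m%:R * S) * delta k.
  apply: filterS AK => k Hk; apply: le_trans (HC _ _) _.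
  have zk i0 : Cnorm n.+1 (z k i0) <= S * delta k.
    (* Both sides equal - L_k y, because L y = 0 and L_k y_k = 0. *)
    rewrite /delta; have -> : diffop A y - diffop (A_ k) y = diffop (A_ k) (z k).
      rewrite diffopB (matrix_cauchy_diffop _ Y_sol).
      by rewrite (matrix_cauchy_diffop _ (Y__sol k)).
    apply: HS => // i1; rewrite Cvec_subE.
    transitivity (Ccol (Y_ k) j i1 (@seg_left _ _ _ hab) - Ccol Y j i1 (@seg_left _ _ _ hab)); first by [].
    by rewrite (matrix_cauchy_left _ _ Y_sol) (matrix_cauchy_left _ _ (Y__sol k)) subrr.
  have zN : Cvec_rnorm (z k) <= m%:R * (S * delta k).
    apply: (@le_trans _ _ (\sum_(i0 < m) S * delta k)); first exact: ler_sum.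
    by rewrite sumr_const card_ord -(mulr_natl (S * delta k) m).
  (* The sign of [C] is unknown; its absolute value makes the bound monotone in the norm. *)
  apply: (@le_trans _ _ (`|C| * Cvec_rnorm (z k))).
    by rewrite ler_wpM2r ?ler_norm // (seminorm_ge0 _ sN).
  by rewrite -!mulrA ler_wpM2l.
set T := `|C| * (m%:R * S) in zle.
have T0 : 0 <= T by rewrite !mulr_ge0.
apply/cvg_complexP => e e0.
have e20 : 0 < e / 2 by rewrite divr_gt0.
(* [T] may be 0, hence the division by T + 1. *)
have T1 : 0 < T + 1 by rewrite ltr_wpDl.
have eT0 : 0 < e / 2 / (T + 1) by rewrite divr_gt0.
have dk : \forall k \near \oo, delta k < e / 2 / (T + 1).
  by have /Cvec_cvgP := sotA y; exact.
have /cvg_complexP/(_ _ e20) := sotB y i.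
apply: filterS3 zle dk => k Hz Hd HB.
have -> : B (Ccol Y j) i 0 - B_ k (Ccol (Y_ k) j) i 0 =
    (B y i 0 - B_ k y i 0) - B_ k (z k) i 0.
  by rewrite /z linearB !mxE -/y; ring.
apply: le_lt_trans (Re_normD _ _) _; rewrite normrN -/(q k (z k)).
have h1 : T * delta k <= (T + 1) * (e / 2 / (T + 1)).
  apply: ler_pM => //; last exact: ltW; last by rewrite lerDl.
  exact: seminorm_ge0 (Cvec_rnorm_seminorm hab n m).
have h2 : (T + 1) * (e / 2 / (T + 1)) = e / 2 by rewrite mulrC divfK // gt_eqF.
rewrite h2 in h1; lra.
Qed.
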